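(* Let $\ell,s,t\ge1$ and $h\ge2$ be integers. The initial ideal $\mathrm{in}_\prec(I_{B_{\ell,h}^{s,t}})=(m_1,\ldots,m_{h^2})$ has $\ell$-regular quotients with respect to the order $m_1,\ldots,m_{h^2}$ of its generators. More precisely, for $k=2,\ldots,h^2$ the colon ideal $(m_1,\ldots,m_{k-1}):m_k$ is generated by a regular sequence of length $r_k$ in the single degree $\ell$, where $$(r_2,\ldots,r_{\frac{h(h-1)}{2}})=(\underbrace{1,1}_{2},\underbrace{2,2,2}_{3},\ldots,\underbrace{h-2,h-2,\ldots,h-2}_{h-1});$$ and if $\frac{h(h-1)}{2}+1\le k\le h^2$, then $h-1\le r_k\le 2h-2$. Moreover, for any $p$ with $h-1\le p\le 2h-2$, one has $$\Big|\Big\{\tfrac{h(h-1)}{2}+1\le k\le h^2 : r_k=p\Big\}\Big|=2h-p-1.$$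
   Context: $\mathbb{K}$ is a field. The graph $B_{\ell,h}^{s,t}$ is obtained from $h$ otherwise disjoint paths of length $2\ell$ joining two vertices $y_1$ and $y_2$ by attaching an odd cycle of length $2s+1$ at $y_1$ and an odd cycle of length $2t+1$ at $y_2$. Explicitly, its vertices are $y_1,y_2$, $x_{i,j}$ ($1\le i\le 2\ell-1$, $1\le j\le h$), $z_1,\ldots,z_{2s}$, $w_1,\ldots,w_{2t}$, and its edges are: $e_{1,j}=\{y_1,x_{1,j}\}$, $e_{i,j}=\{x_{i-1,j},x_{i,j}\}$ for $2\le i\le 2\ell-1$, $e_{2\ell,j}=\{x_{2\ell-1,j},y_2\}$ ($1\le j\le h$); $f_1=\{y_1,z_1\}$, $f_i=\{z_{i-1},z_i\}$ for $2\le i\le 2s$, $f_{2s+1}=\{z_{2s},y_1\}$; $g_1=\{y_2,w_1\}$, $g_i=\{w_{i-1},w_i\}$ for $2\le i\le 2t$, $g_{2t+1}=\{w_{2t},y_2\}$. For a simple graph $G$ with edge set $E$, the toric ideal $I_G$ is the kernel of the $\mathbb{K}$-algebra map from the polynomial ring $\mathbb{K}[E]$ (variables indexed by edges) to the polynomial ring on the vertices, sending an edge $\{a,b\}$ to $ab$. $\prec$ is the graded reverse lexicographic order on the polynomial ring in the variables $e_{i,j},f_i,g_i$ with the variables ordered as $e_{1,1}\succ\cdots\succ e_{1,h}\succ e_{3,1}\succ\cdots\succ e_{3,h}\succ\cdots\succ e_{2\ell-1,1}\succ\cdots\succ e_{2\ell-1,h}\succ g_1\succ\cdots\succ g_{2t+1}\succ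 f_1\succ\cdots\succ f_{2s+1}\succ e_{2,1}\succ\cdots\succ e_{2,h}\succ e_{4,1}\succ\cdots\succ e_{4,h}\succ\cdots\succ e_{2\ell,1}\succ\cdots\succ e_{2\ell,h}$. Put $Y_{1,i}=\prod_{p=1}^{\ell}e_{2p-1,i}$, $Y_{2,i}=\prod_{p=1}^{\ell}e_{2p,i}$ for $1\le i\le h$, and $U=\prod_{p=1}^{s}f_{2p}\prod_{p=1}^{t+1}g_{2p-1}$. The minimal generators of $\mathrm{in}_\prec(I_{B_{\ell,h}^{s,t}})$ are $Y_{1,j}Y_{2,i}$ and $Y_{1,i}Y_{1,j}U$ for $1\le i<j\le h$, and $Y_{1,i}^2U$ for $1\le i\le h$. They are listed as $m_1,\ldots,m_{h^2}$ as follows. Order the pairs $(i,j)$ with $1\le i<j\le h$ by letting $i$ decrease from $h-1$ to $1$ and, for fixed $i$, letting $j$ decrease from $h$ to $i+1$. The generators $m_1,\ldots,m_{h(h-1)/2}$ are the $Y_{1,j}Y_{2,i}$ in this order (so $m_1=Y_{1,h}Y_{2,h-1}$, $m_2=Y_{1,h}Y_{2,h-2}$, $m_3=Y_{1,h-1}Y_{2,h-2}$, ..., $m_{h(h-1)/2}=Y_{1,2}Y_{2,1}$); $m_{h(h-1)/2+1},\ldots,m_{h(h-1)}$ are the $Y_{1,j}Y_{1,i}U$ in this order (from $Y_{1,h}Y_{1,h-1}U$ to $Y_{1,2}Y_{1,1}U$); and $m_{h(h-1)+1}=Y_{1,h}^2U,\ m_{h(h-1)+2}=Y_{1,h-1}^2U,\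 \ldots,\ m_{h^2}=Y_{1,1}^2U$. A monomial ideal minimally generated by $f_1,\ldots,f_m$ has $a$-regular quotients with respect to this order if $(f_1,\ldots,f_{i-1}):f_i$ is generated by a regular sequence of monomials all of degree $a$, for each $i=2,\ldots,m$. *)

(* Defs.v *)
From HB Require Import structures.
From mathcomp Require Import all_boot all_order all_algebra.
From mathcomp Require Import mpoly zify.

Set Implicit Arguments.
Unset Strict Implicit.
Unset Printing Implicit Defensive.

Import GRing.Theory.
Local Open Scope ring_scope.

(* Ideals are Prop-valued predicates, since membership in them is not given by
   a boolean test. *)
Definition ideal_gen (R : comNzRingType) (S : R -> Prop) (p : R) : Prop :=
  exists (n : nat) (c g : 'I_n -> R),
    (forall i, S (g i)) /\ p = \sum_(i < n) c i * g i.

Definition seq_ideal (R : comNzRingType) (s : seq R) : R -> Prop :=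
  ideal_gen (fun q => q \in s).

Definition colon (R : comNzRingType) (I : R -> Prop) (f : R) : R -> Prop :=
  fun p => I (p * f).

Definition same_ideal (R : comNzRingType) (I J : R -> Prop) : Prop :=
  forall p, I p <-> J p.

(* Each element is a nonzerodivisor modulo the preceding ones, and the quotient
   by all of them is nonzero. *)
Definition regular_sequence (R : comNzRingType) (s : seq R) : Prop :=
  (forall i, (i < size s)%N ->
     forall p, seq_ideal (take i s) (p * s`_i) -> seq_ideal (take i s) p)
  /\ ~ seq_ideal s 1.

Section Monomials.

Variables (K : fieldType) (n : nat).
Implicit Types (I : {mpoly K[n]} -> Prop) (ms gs : seq 'X_{1..n}).

Definition mon_ideal ms : {mpoly K[n]} -> Prop :=
  seq_ideal [seq 'X_[K, m] | m <- ms].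

Definition minimally_generated I ms : Prop :=
  same_ideal I (mon_ideal ms) /\
  forall i, (i < size ms)%N ->
    ~ mon_ideal (take i ms ++ drop i.+1 ms) 'X_[K, nth 0%MM ms i].

(* [k] is the 1-based position of m_k in the list [ms]. *)
Definition colon_regular (a : nat) ms (k r : nat) : Prop :=
  exists gs,
    [/\ size gs = r,
        all (fun m => mdeg m == a) gs,
        regular_sequence [seq 'X_[K, m] | m <- gs]
      & same_ideal
          (colon (mon_ideal (take k.-1 ms)) 'X_[K, nth 0%MM ms k.-1])
          (mon_ideal gs)].

Definition has_regular_quotients (a : nat) I ms : Prop :=
  minimally_generated I ms /\
  forall k, (2 <= k <= size ms)%N -> exists r, colon_regular a ms k r.

(* [prec u v] means that the monomial [u] is strictly smaller than [v]. *)
Definition is_initial_monomial (prec : rel 'X_{1..n}) (p : {mpoly K[n]})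
    (m : 'X_{1..n}) : Prop :=
  m \in msupp p /\ forall m', m' \in msupp p -> m' != m -> prec m' m.

Definition initial_ideal (prec : rel 'X_{1..n}) I : {mpoly K[n]} -> Prop :=
  ideal_gen (fun q => exists p m,
    [/\ I p, is_initial_monomial prec p m & q = 'X_[K, m]]).

End Monomials.

(* For a finite type [T], polynomials in variables indexed by [T] are elements
   of {mpoly K[#|T|]}, the variable of [x : T] being 'X_(enum_rank x). *)
Definition mvar (T : finType) (x : T) : 'X_{1..#|T|} := U_(enum_rank x)%MM.

(* Graded reverse lexicographic order, the variables being listed in [vs] from
   the largest to the smallest: in equal degree, u < v when u has the larger
   exponent at the smallest variable where u and v differ. *)
Definition grevlex (T : finType) (vs : seq T) : rel 'X_{1..#|T|} :=
  fun u v =>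
    (mdeg u < mdeg v)%N ||
    (mdeg u == mdeg v) &&
    [exists x : T, (v (enum_rank x) < u (enum_rank x))%N &&
      [forall y : T, (index x vs < index y vs)%N ==>
        (u (enum_rank y) == v (enum_rank y))]].

(* A finite graph is given by its vertex type [V], its edge type [E] and the
   set of endpoints of each edge. *)
Definition simple_graph (V E : finType) (ends : E -> {set V}) : Prop :=
  injective ends /\ forall e, #|ends e| = 2.

Definition toric_map (K : fieldType) (V E : finType) (ends : E -> {set V}) :
    {mpoly K[#|E|]} -> {mpoly K[#|V|]} :=
  mmap (@mpolyC #|V| K)
       (fun i => \prod_(v in ends (enum_val i)) 'X_[K, mvar v]).

Definition toric_ideal (K : fieldType) (V E : finType) (ends : E -> {set V}) :
    {mpoly K[#|E|]} -> Prop :=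
  fun p => toric_map ends p = 0.

Arguments toric_ideal K {V E} ends p.

(* All ordinal indices below are 0-based: [BX i j] is x_{i+1,j+1}, [Be i j] is
   e_{i+1,j+1}, [Bz i] is z_{i+1}, and so on. *)
Inductive Bvert (l s t h : nat) : Type :=
  | By1 | By2
  | BX of 'I_(2 * l - 1) & 'I_h
  | Bz of 'I_(2 * s)
  | Bw of 'I_(2 * t).

Inductive Bedge (l s t h : nat) : Type :=
  | Be of 'I_(2 * l) & 'I_h
  | Bf of 'I_(2 * s + 1)
  | Bg of 'I_(2 * t + 1).

Arguments By1 {l s t h}.
Arguments By2 {l s t h}.
Arguments BX {l s t h}.
Arguments Bz {l s t h}.
Arguments Bw {l s t h}.
Arguments Be {l s t h}.
Arguments Bf {l s t h}.
Arguments Bg {l s t h}.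

Section Finiteness.

Variables (l s t h : nat).

Definition Bvert_code (v : Bvert l s t h) :
    bool + ('I_(2 * l - 1) * 'I_h) + 'I_(2 * s) + 'I_(2 * t) :=
  match v with
  | By1 => inl (inl (inl true))
  | By2 => inl (inl (inl false))
  | BX i j => inl (inl (inr (i, j)))
  | Bz i => inl (inr i)
  | Bw i => inr i
  end.

Definition Bvert_decode
    (c : bool + ('I_(2 * l - 1) * 'I_h) + 'I_(2 * s) + 'I_(2 * t)) :
    Bvert l s t h :=
  match c with
  | inl (inl (inl b)) => if b then By1 else By2
  | inl (inl (inr (i, j))) => BX i j
  | inl (inr i) => Bz i
  | inr i => Bw i
  end.

Lemma Bvert_codeK : cancel Bvert_code Bvert_decode.
Proof. by case. Qed.

HB.instance Definition _ := Countable.copy (Bvert l s t h) (can_type Bvert_codeK).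
HB.instance Definition _ : isFinite (Bvert l s t h) := CanIsFinite Bvert_codeK.

Definition Bedge_code (e : Bedge l s t h) :
    ('I_(2 * l) * 'I_h) + 'I_(2 * s + 1) + 'I_(2 * t + 1) :=
  match e with
  | Be i j => inl (inl (i, j))
  | Bf i => inl (inr i)
  | Bg i => inr i
  end.

Definition Bedge_decode
    (c : ('I_(2 * l) * 'I_h) + 'I_(2 * s + 1) + 'I_(2 * t + 1)) :
    Bedge l s t h :=
  match c with
  | inl (inl (i, j)) => Be i j
  | inl (inr i) => Bf i
  | inr i => Bg i
  end.

Lemma Bedge_codeK : cancel Bedge_code Bedge_decode.
Proof. by case. Qed.

HB.instance Definition _ := Countable.copy (Bedge l s t h) (can_type Bedge_codeK).
HB.instance Definition _ : isFinite (Bedge l s t h) := CanIsFinite Bedge_codeK.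

End Finiteness.

Section Bgraph.

Variables (l s t h : nat).

Local Notation vert := (Bvert l s t h).
Local Notation edge := (Bedge l s t h).

(* k-th vertex of the j-th path: y_1 for k = 0, x_{k,j} for 1 <= k <= 2l-1,
   and y_2 for k = 2l. *)
Definition path_vertex (j : 'I_h) (k : nat) : vert :=
  match k with
  | 0 => By1
  | k'.+1 => if insub k' is Some i then BX i j else By2
  end.

(* y_1, z_1, ..., z_{2s}, y_1 for k = 0, 1, ..., 2s, 2s+1. *)
Definition zcycle_vertex (k : nat) : vert :=
  match k with
  | 0 => By1
  | k'.+1 => if insub k' is Some i then Bz i else By1
  end.

Definition wcycle_vertex (k : nat) : vert :=
  match k with
  | 0 => By2
  | k'.+1 => if insub k' is Some i then Bw i else By2
  end.

Definition Bends (e : edge) : {set vert} :=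
  match e with
  | Be i j => [set path_vertex j i; path_vertex j i.+1]
  | Bf i => [set zcycle_vertex i; zcycle_vertex i.+1]
  | Bg i => [set wcycle_vertex i; wcycle_vertex i.+1]
  end.

Lemma path_vertexP j k j' k' : (k <= 2 * l)%N -> (k' <= 2 * l)%N ->
  path_vertex j k = path_vertex j' k' ->
  k = k' /\ ((0 < k < 2 * l)%N -> j = j').
Proof.
case: k k' => [|k] [|k'] //= lek lek'; first by case: insubP.
  by case: insubP.
case: insubP => [u _ uk|Nk]; case: insubP => [u' _ uk'|Nk'] //.
  by case=> uu' ->; split=> //; rewrite -uk uu' uk'.
by move=> _; split; lia.
Qed.

Lemma zcycle_vertexP k k' : (k <= 2 * s + 1)%N -> (k' <= 2 * s + 1)%N ->
  zcycle_vertex k = zcycle_vertex k' ->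
  k = k' \/ (k \in [:: 0; 2 * s + 1]%N) && (k' \in [:: 0; 2 * s + 1]%N).
Proof.
rewrite !inE; case: k k' => [|k] [|k'] //= lek lek'; first by left.
- by case: insubP => // Nk _; right; lia.
- by case: insubP => // Nk _; right; lia.
case: insubP => [u _ uk|Nk]; case: insubP => [u' _ uk'|Nk'] //.
  by case=> uu'; left; rewrite -uk uu' uk'.
by move=> _; right; lia.
Qed.

Lemma wcycle_vertexP k k' : (k <= 2 * t + 1)%N -> (k' <= 2 * t + 1)%N ->
  wcycle_vertex k = wcycle_vertex k' ->
  k = k' \/ (k \in [:: 0; 2 * t + 1]%N) && (k' \in [:: 0; 2 * t + 1]%N).
Proof.
rewrite !inE; case: k k' => [|k] [|k'] //= lek lek'; first by left.
- by case: insubP => // Nk _; right; lia.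
- by case: insubP => // Nk _; right; lia.
case: insubP => [u _ uk|Nk]; case: insubP => [u' _ uk'|Nk'] //.
  by case=> uu'; left; rewrite -uk uu' uk'.
by move=> _; right; lia.
Qed.

Lemma set2_eq (T : finType) (a b c d : T) : [set a; b] = [set c; d] ->
  (a = c /\ b = d) \/ (a = d /\ b = c).
Proof.
move=> E; have:= set21 a b; have:= set22 a b; rewrite E !inE.
move=> /orP[] /eqP eb /orP[] /eqP ea; subst; auto.
- by have:= set22 c d; rewrite -E !inE orbb => /eqP ->; left.
- by have:= set21 c d; rewrite -E !inE orbb => /eqP ->; left.
Qed.

Definition bz (v : vert) := if v is Bz _ then true else false.
Definition bw (v : vert) := if v is Bw _ then true else false.

Lemma Bgraph_simple : (0 < l)%N -> (0 < s)%N -> (0 < t)%N -> simple_graph Bends.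
Proof.
move=> l0 s0 t0.
have kind e : ([exists v in Bends e, bz v], [exists v in Bends e, bw v]) =
  match e with Be _ _ => (false, false) | Bf _ => (true, false) | Bg _ => (false, true) end.
  have pz j k : bz (path_vertex j k) = false by case: k => //= k; case: insub.
  have pw j k : bw (path_vertex j k) = false by case: k => //= k; case: insub.
  have zw k : bw (zcycle_vertex k) = false by case: k => //= k; case: insub.
  have wz k : bz (wcycle_vertex k) = false by case: k => //= k; case: insub.
  have zz k : (0 < k <= 2 * s)%N -> bz (zcycle_vertex k).
    by case: k => //= k lek; rewrite insubT.
  have ww k : (0 < k <= 2 * t)%N -> bw (wcycle_vertex k).
    by case: k => //= k lek; rewrite insubT.
  have none (p : pred vert) a b : p a = false -> p b = false ->
      [exists v in [set a; b], p v] = false.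
    move=> pa pb; apply/existsP=> -[v]; rewrite !inE.
    by case/andP=> /orP[] /eqP->; rewrite ?pa ?pb.
  have some (p : pred vert) a b : p a || p b -> [exists v in [set a; b], p v].
    by case/orP=> pv; apply/existsP; [exists a|exists b]; rewrite !inE eqxx ?orbT pv.
  case: e => [i j|i|i]; lazy beta iota delta [Bends]; congr (_, _);
    try by rewrite none ?pz ?pw ?zw ?wz.
    by apply: some; have := ltn_ord i; case: (posnP i) => i0 lei; apply/orP;
      [right|left]; apply: zz; lia.
  by apply: some; have := ltn_ord i; case: (posnP i) => i0 lei; apply/orP;
    [right|left]; apply: ww; lia.
split=> [e e' Ee|e].
  have := kind e; rewrite Ee kind.
  case: e e' Ee => [i j|i|i] [i' j'|i'|i'] //; lazy beta iota delta [Bends] => Ee _;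
    have lei := ltn_ord i; have lei' := ltn_ord i'.
  - case: (set2_eq Ee) => -[/path_vertexP E1 /path_vertexP E2].
      have [] := E1; try lia; move=> /val_inj ii' jj1.
      have [] := E2; try lia; move=> _ jj2; congr Be => //.
      by case: (posnP i) => i0; [apply: jj2|apply: jj1]; lia.
    by have [] := E1; try lia; have [] := E2; lia.
  - case: (set2_eq Ee) => -[/zcycle_vertexP E1 /zcycle_vertexP E2];
    rewrite !inE in E1 E2; congr Bf; apply: val_inj => /=; lia.
  - case: (set2_eq Ee) => -[/wcycle_vertexP E1 /wcycle_vertexP E2];
    rewrite !inE in E1 E2; congr Bg; apply: val_inj => /=; lia.
case: e => [i j|i|i]; rewrite cards2; have lei := ltn_ord i;
  case: eqP => //.
- by case/path_vertexP; lia.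
- by move/zcycle_vertexP; rewrite !inE; lia.
- by move/wcycle_vertexP; rewrite !inE; lia.
Qed.

(* In what follows [odd i.+1] is the parity of the 1-based index i+1. *)
Definition Bvars : seq edge :=
     [seq Be i j | i <- [seq i : 'I_(2 * l) <- enum 'I_(2 * l) | odd i.+1],
                   j <- enum 'I_h]
  ++ [seq Bg i | i <- enum 'I_(2 * t + 1)]
  ++ [seq Bf i | i <- enum 'I_(2 * s + 1)]
  ++ [seq Be i j | i <- [seq i : 'I_(2 * l) <- enum 'I_(2 * l) | ~~ odd i.+1],
                   j <- enum 'I_h].

(* Monomials are exponent vectors, so products of monomials are sums. *)
Definition Ymon1 (j : 'I_h) : 'X_{1..#|{: edge}|} :=
  (\sum_(i < 2 * l | odd i.+1) mvar (Be i j : edge))%MM.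

Definition Ymon2 (j : 'I_h) : 'X_{1..#|{: edge}|} :=
  (\sum_(i < 2 * l | ~~ odd i.+1) mvar (Be i j : edge))%MM.

Definition Umon : 'X_{1..#|{: edge}|} :=
  (\sum_(i < 2 * s + 1 | ~~ odd i.+1) mvar (Bf i : edge) +
   \sum_(i < 2 * t + 1 | odd i.+1) mvar (Bg i : edge))%MM.

(* Pairs i < j, with i decreasing and, for fixed i, j decreasing. *)
Definition Bpairs : seq ('I_h * 'I_h) :=
  [seq p : 'I_h * 'I_h
     <- [seq (i, j) | i <- rev (enum 'I_h), j <- rev (enum 'I_h)]
   | (p.1 < p.2)%N].

Definition Bgens : seq 'X_{1..#|{: edge}|} :=
     [seq (Ymon1 p.2 + Ymon2 p.1)%MM | p <- Bpairs]
  ++ [seq (Ymon1 p.2 + Ymon1 p.1 + Umon)%MM | p <- Bpairs]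
  ++ [seq (Ymon1 i + Ymon1 i + Umon)%MM | i <- rev (enum 'I_h)].

End Bgraph.

(* Main.v *)
Require Import Defs.
From mathcomp Require Import all_boot all_order all_algebra.
From mathcomp Require Import mpoly zify.

Set Implicit Arguments.
Unset Strict Implicit.
Unset Printing Implicit Defensive.

(** The two halves of the statement, the description of the initial ideal and
    that of the colon ideals, both become questions of divisibility between
    monomials, because an ideal generated by monomials is determined by the
    monomials that its generators divide ([ideal_gen_monomials]).

    Initial ideal.  The image of a monomial under the toric map records its
    total exponent at every vertex, and the coefficients of an element of the
    toric ideal sum to zero over each set of monomials with the same image.
    Hence an initial monomial [m] is accompanied by some smaller [m'] with the
    same image ([toric_initial_fibre]).  All vertices but [y_1] and [y_2] have
    degree two, so the difference of [m] and [m'] alternates in sign along each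
    path and each cycle: it is given by one integer [a j] per path and one
    integer [c] for the two cycles, and the balance at [y_1] and [y_2] forces
    the sum of the [a j] to be [2 c] ([fibre_diff]).  As [m'] is smaller, the
    last [a j] that is not zero is positive, and reading off the signs of the
    others shows that one of the listed generators divides [m]
    ([fibre_divisible]).  Conversely each listed generator leads the binomial of
    a closed even walk ([Bgens_initial]).

    Colon ideals.  Distinct monomials among the [Y1 j], the [Y2 i] and [U] have
    no variable in common.  So for two generators [g] and [f] the monomials [m]
    for which [g] divides [m f] are the multiples of the product of the factors
    of [g] missing in [f].  For each of the three blocks of
    generators the products that arise from the preceding generators are all
    divisible by single factors [Y1 b] or [Y2 a] that arise themselves
    ([colon_Y1Y2], [colon_Y1Y1U], [colon_Y1sqU]).  Distinct factors of degree
    [l] on disjoint variables form a regular sequence, whose length is a count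
    of indices; for [0]-based indices [i < j] the counts are [h - 2 - i] for
    [Y1 j Y2 i], [h - 2 - i + j] for [Y1 j Y1 i U] and [h - 1 + i] for
    [Y1 i ^ 2 U].  The value [p] is thus taken once for each pair with
    [j - i = p + 2 - h], and once more by a square. *)

(** * Monomial ideals *)

Section MonomialIdeals.

Import GRing.Theory.
Local Open Scope ring_scope.

Variables (K : fieldType) (n : nat).
Implicit Types (m g f u v : 'X_{1..n}) (ms gs : seq 'X_{1..n}).
Implicit Types (p q : {mpoly K[n]}).

(** An ideal generated by monomials is spanned by the monomials that a
    generator divides, so membership can be tested on the support.  This turns
    every later question on ideals into one on divisibility of exponents. *)
Lemma ideal_gen_monomials (S : {mpoly K[n]} -> Prop) (A : 'X_{1..n} -> Prop) :
  (forall q, S q <-> exists2 m, A m & q = 'X_[K, m]) ->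
  forall p, ideal_gen S p <->
    (forall m, m \in msupp p -> exists2 g, A g & (g <= m)%MM).
Proof.
move=> SA p; split=> [[k [c [g [Sg ->]]]] m | divp].
  move=> /msupp_sum_le /flattenP[_ /mapP[i _ ->]].
  have [a Aa ->] := (SA (g i)).1 (Sg i).
  move=> /msuppM_le /allpairsP[[u v] /= [_]].
  rewrite msuppX inE => /eqP-> ->; exists a => //; exact: lem_addl.
pose s := msupp p.
have /fin_all_exists[g gP] (i : 'I_(size s)) :
    exists g, A g /\ (g <= nth 0%MM s i)%MM.
  by have [g Ag gle] := divp _ (mem_nth 0%MM (ltn_ord i)); exists g.
exists (size s).
exists (fun i : 'I_(size s) => p@_(nth 0%MM s i) *: 'X_[nth 0%MM s i - g i]).
exists (fun i : 'I_(size s) => 'X_[g i]); split=> [i|].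
  by apply/SA; exists (g i) => //; case: (gP i).
rewrite {1}[p]mpolyE (big_nth 0%MM) big_mkord; apply: eq_bigr => i _.
by rewrite -scalerAl -mpolyXD submK //; case: (gP i).
Qed.

Lemma mon_idealP ms p :
  mon_ideal ms p <->
  (forall m, m \in msupp p -> exists2 g, g \in ms & (g <= m)%MM).
Proof.
apply: ideal_gen_monomials => q; split=> [/mapP[m msm ->]|[m msm ->]].
  by exists m.
exact: map_f.
Qed.

Lemma mon_ideal_monomial ms m :
  mon_ideal ms 'X_[K, m] <-> exists2 g, g \in ms & (g <= m)%MM.
Proof.
rewrite mon_idealP msuppX; split=> [|ex _ /[!inE] /eqP-> //].
by apply; rewrite inE.
Qed.

Lemma mon_ideal_mulX ms f p :
  mon_ideal ms (p * 'X_[K, f]) <->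
  (forall m, m \in msupp p -> exists2 g, g \in ms & (g <= m + f)%MM).
Proof.
rewrite mon_idealP; split=> div m.
  move=> mp; apply: div; rewrite (perm_mem (msuppMX _ _)).
  by apply/mapP; exists m; rewrite // addmC.
rewrite (perm_mem (msuppMX _ _)) => /mapP[m' m'p ->].
by rewrite addmC; apply: div.
Qed.

Lemma colon_mon_ideal ms f gs :
  (forall m, (exists2 g, g \in ms & (g <= m + f)%MM) <->
             (exists2 g, g \in gs & (g <= m)%MM)) ->
  same_ideal (colon (mon_ideal ms) 'X_[K, f]) (mon_ideal gs).
Proof.
move=> msgs p; rewrite /colon mon_ideal_mulX mon_idealP.
by split=> div m mp; apply/msgs/div.
Qed.

Definition coprime_mnm u v := [forall i, (u i == 0%N) || (v i == 0%N)].

Lemma coprime_mnmP u v :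
  reflect (forall i, u i = 0%N \/ v i = 0%N) (coprime_mnm u v).
Proof.
apply: (iffP forallP) => cuv i; have := cuv i.
  by case/orP=> /eqP; [left|right].
by case=> ->; rewrite eqxx ?orbT.
Qed.

Lemma coprime_mnm_sym u v : coprime_mnm u v -> coprime_mnm v u.
Proof.
by move/coprime_mnmP=> cuv; apply/coprime_mnmP => i; case: (cuv i); auto.
Qed.

Lemma coprime_mnmD u v w :
  coprime_mnm u v -> coprime_mnm u w -> coprime_mnm u (v + w)%MM.
Proof.
move=> /coprime_mnmP cuv /coprime_mnmP cuw; apply/coprime_mnmP => i.
by rewrite mnmDE; case: (cuv i) (cuw i) => [|->] [] ->; auto.
Qed.

Lemma lepm0 u : (u <= 0)%MM -> u = 0%MM.
Proof.
move=> /mnm_lepP u0; apply/mnmP => i; apply/eqP.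
by have := u0 i; rewrite mnm0E leqn0.
Qed.

(** Gauss's lemma for monomials; the intermediate [g] saves separate appeals to
    transitivity when [u] is one factor of a generator. *)
Lemma coprime_mnm_cancel u g v m :
  (u <= g)%MM -> coprime_mnm u v -> (g <= m + v)%MM -> (u <= m)%MM.
Proof.
move=> /mnm_lepP ug /coprime_mnmP cuv /mnm_lepP gmv; apply/mnm_lepP => i.
have := cuv i; have := ug i; have := gmv i; rewrite mnmDE; lia.
Qed.

Lemma coprime_mnm_0 u g v :
  (u <= g)%MM -> coprime_mnm u v -> (g <= v)%MM -> u = 0%MM.
Proof.
move=> ug cuv gv; apply/lepm0.
by apply: coprime_mnm_cancel ug cuv _; rewrite add0m.
Qed.

(** Modulo monomials coprime to [g], multiplication by [g] is injective: a
    generator dividing [m * g] already divides [m]. *)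
Lemma coprime_regular gs :
  pairwise coprime_mnm gs ->
  all (fun u => u != 0%MM) gs ->
  regular_sequence [seq 'X_[K, m] | m <- gs].
Proof.
move=> cop nz; rewrite /regular_sequence size_map.
split=> [i ilt p|]; last first.
  move=> /mon_idealP /(_ 0%MM); rewrite msupp1 inE eqxx => -[] // g ggs g0.
  by have /eqP[] := allP nz _ ggs; apply: lepm0.
rewrite -map_take (nth_map 0%MM) // => /mon_ideal_mulX div.
apply/mon_idealP => m /div[g gin gle]; exists g => //.
apply: coprime_mnm_cancel (lepm_refl g) _ gle.
move: cop; rewrite -{1}(cat_take_drop i gs) pairwise_cat.
case/andP=> /allrelP cop _.
by apply: cop => //; rewrite (drop_nth 0%MM) // mem_head.
Qed.

(** Divisibility being the only way into a monomial ideal, an antichain of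
    monomials is a minimal generating set. *)
Lemma antichain_minimal (I : {mpoly K[n]} -> Prop) ms :
  same_ideal I (mon_ideal ms) ->
  pairwise (fun u v => ~~ (u <= v)%MM && ~~ (v <= u)%MM) ms ->
  minimally_generated I ms.
Proof.
move=> Ims anti; split=> // i ilt /mon_ideal_monomial[g].
move: anti; rewrite -{1}(cat_take_drop i ms) (drop_nth 0%MM) // mem_cat.
rewrite pairwise_cat /= => /and3P[/allrelP A _ /andP[/allP B _]].
case/orP=> gin; last by case/andP: (B _ gin) => _ /negP.
by case/andP: (A _ (nth 0%MM ms i) gin (mem_head _ _)) => /negP.
Qed.

Lemma initial_ideal_monomials (prec : rel 'X_{1..n})
    (I : {mpoly K[n]} -> Prop) ms :
  (forall p m, I p -> is_initial_monomial prec p m ->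
     exists2 g, g \in ms & (g <= m)%MM) ->
  (forall g, g \in ms -> exists2 p, I p & is_initial_monomial prec p g) ->
  same_ideal (initial_ideal prec I) (mon_ideal ms).
Proof.
move=> ini gen p.
have E := @ideal_gen_monomials _
  (fun m => exists2 p, I p & is_initial_monomial prec p m) _ p.
rewrite /initial_ideal E; last first.
  move=> q; split=> [[p' [m [Ip inp ->]]]|[m [p' Ip inp] ->]].
    by exists m => //; exists p'.
  by exists p', m.
rewrite mon_idealP; split=> div m /div[g].
  case=> p' Ip inp gm; have [g' g'ms g'g] := ini _ _ Ip inp.
  by exists g' => //; apply: lepm_trans gm.
by move=> gms gm; exists g => //; apply: gen.
Qed.

End MonomialIdeals.

(** * Exponents and degrees of the monomials [Y1], [Y2] and [U] *)

Section Exponents.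

Variable T : finType.
Implicit Types (u v : 'X_{1..#|T|}) (x : T).

Definition expo u x : nat := u (enum_rank x).

Lemma expoD u v x : expo (u + v)%MM x = expo u x + expo v x.
Proof. exact: mnmDE. Qed.

Lemma expo_mvar x y : expo (mvar x) y = (x == y).
Proof. by rewrite /expo /mvar mnm1E (inj_eq enum_rank_inj). Qed.

Lemma expo_sum (I : Type) (r : seq I) (P : pred I) (F : I -> 'X_{1..#|T|}) x :
  expo (\sum_(i <- r | P i) F i)%MM x = \sum_(i <- r | P i) expo (F i) x.
Proof. exact: mnm_sumE. Qed.

Lemma expo_lepP u v : reflect (forall x, expo u x <= expo v x) (u <= v)%MM.
Proof.
apply: (iffP mnm_lepP) => uv x; first exact: uv.
by have := uv (enum_val x); rewrite /expo enum_valK.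
Qed.

Lemma expoP u v : (forall x, expo u x = expo v x) -> u = v.
Proof.
by move=> uv; apply/mnmP => i; have := uv (enum_val i); rewrite /expo enum_valK.
Qed.

Lemma expo_coprime u v :
  (forall x, expo u x = 0 \/ expo v x = 0) -> coprime_mnm u v.
Proof.
by move=> uv; apply/coprime_mnmP => i; have := uv (enum_val i);
  rewrite /expo enum_valK.
Qed.

End Exponents.

Lemma sum_pred1 (I : finType) (P : pred I) (k : I) :
  \sum_(i | P i) (i == k : nat) = P k.
Proof.
rewrite big_mkcond (bigD1 k) //= eqxx big1 => [|i /negPf ->].
  by rewrite addn0; case: (P k).
by case: (P i).
Qed.

Lemma sum_pred1_and (I : finType) (P : pred I) (k : I) (b : bool) :
  \sum_(i | P i) ((i == k) && b : nat) = P k && b.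
Proof.
case: b; last by rewrite andbF big1 // => i _; rewrite andbF.
by rewrite andbT -sum_pred1; apply: eq_bigr => i _; rewrite andbT.
Qed.

Lemma sum_odd n : \sum_(i < n | odd i.+1) 1 = uphalf n.
Proof.
elim: n => [|n IHn]; first by rewrite big_ord0.
by rewrite big_mkcond big_ord_recr /= -big_mkcond /= IHn; case: ifP; lia.
Qed.

Lemma sum_even n : \sum_(i < n | ~~ odd i.+1) 1 = n./2.
Proof.
elim: n => [|n IHn]; first by rewrite big_ord0.
by rewrite big_mkcond big_ord_recr /= -big_mkcond /= IHn; case: ifP; lia.
Qed.

Section Factors.

Variables (l s t h : nat).
Implicit Types (i j : 'I_h) (e : Bedge l s t h).

Local Notation Y1 := (@Ymon1 l s t h).
Local Notation Y2 := (@Ymon2 l s t h).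
Local Notation U := (@Umon l s t h).

(** The counterpart of [U]: the closed even walk around both odd cycles and
    along the paths [i] and [j] gives the binomial with terms [Y1 i Y1 j U] and
    [Y2 i Y2 j Vmon]. *)
Definition Vmon : 'X_{1..#|{: Bedge l s t h}|} :=
  (\sum_(i < 2 * s + 1 | odd i.+1) mvar (Bf i : Bedge l s t h) +
   \sum_(i < 2 * t + 1 | ~~ odd i.+1) mvar (Bg i : Bedge l s t h))%MM.

Lemma expo_Ymon1 j e :
  expo (Y1 j) e = if e is Be k c then odd k.+1 && (j == c) : nat else 0.
Proof.
rewrite expo_sum; under eq_bigr do rewrite expo_mvar.
case: e => [k c|k|k]; try by rewrite big1.
exact: (sum_pred1_and (fun i : 'I__ => odd i.+1)).
Qed.

Lemma expo_Ymon2 j e :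
  expo (Y2 j) e = if e is Be k c then ~~ odd k.+1 && (j == c) : nat else 0.
Proof.
rewrite expo_sum; under eq_bigr do rewrite expo_mvar.
case: e => [k c|k|k]; try by rewrite big1.
exact: (sum_pred1_and (fun i : 'I__ => ~~ odd i.+1)).
Qed.

Lemma expo_Umon e :
  expo U e = match e with
             | Be _ _ => 0 | Bf k => ~~ odd k.+1 | Bg k => odd k.+1 end.
Proof.
rewrite expoD !expo_sum; under eq_bigr do rewrite expo_mvar.
under [X in _ + X]eq_bigr do rewrite expo_mvar.
case: e => [k c|k|k]; first by rewrite !big1.
- rewrite [X in _ + X]big1 // addn0.
  exact: (sum_pred1 (fun i : 'I__ => ~~ odd i.+1)).
- rewrite [X in X + _]big1 //.
  exact: (sum_pred1 (fun i : 'I__ => odd i.+1)).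
Qed.

Lemma expo_Vmon e :
  expo Vmon e = match e with
             | Be _ _ => 0 | Bf k => odd k.+1 | Bg k => ~~ odd k.+1 end.
Proof.
rewrite expoD !expo_sum; under eq_bigr do rewrite expo_mvar.
under [X in _ + X]eq_bigr do rewrite expo_mvar.
case: e => [k c|k|k]; first by rewrite !big1.
- rewrite [X in _ + X]big1 // addn0.
  exact: (sum_pred1 (fun i : 'I__ => odd i.+1)).
- rewrite [X in X + _]big1 //.
  exact: (sum_pred1 (fun i : 'I__ => ~~ odd i.+1)).
Qed.

Lemma mdeg_Ymon1 j : mdeg (Y1 j) = l.
Proof.
rewrite mdeg_sum; under eq_bigr do rewrite mdeg1.
by rewrite sum_odd mul2n uphalf_double.
Qed.

Lemma mdeg_Ymon2 j : mdeg (Y2 j) = l.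
Proof.
rewrite mdeg_sum; under eq_bigr do rewrite mdeg1.
by rewrite sum_even mul2n doubleK.
Qed.

Lemma mdeg_Umon : mdeg U = s + t + 1.
Proof.
rewrite mdegD !mdeg_sum; under eq_bigr do rewrite mdeg1.
under [X in _ + X]eq_bigr do rewrite mdeg1.
by rewrite sum_even sum_odd; lia.
Qed.

Lemma mdeg_Vmon : mdeg Vmon = s + t + 1.
Proof.
rewrite mdegD !mdeg_sum; under eq_bigr do rewrite mdeg1.
under [X in _ + X]eq_bigr do rewrite mdeg1.
by rewrite sum_even sum_odd; lia.
Qed.

Lemma coprime_Ymon1 i j : i != j -> coprime_mnm (Y1 i) (Y1 j).
Proof.
move=> nij; apply: expo_coprime => e; rewrite !expo_Ymon1.
case: e => [k c|k|k]; auto; case: (odd k.+1); auto; move: nij.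
by case: (i =P c) => [->|_]; auto; rewrite eq_sym => /negPf ->; auto.
Qed.

Lemma coprime_Ymon2 i j : i != j -> coprime_mnm (Y2 i) (Y2 j).
Proof.
move=> nij; apply: expo_coprime => e; rewrite !expo_Ymon2.
case: e => [k c|k|k]; auto; case: (odd k.+1); auto; move: nij.
by case: (i =P c) => [->|_]; auto; rewrite eq_sym => /negPf ->; auto.
Qed.

Lemma coprime_Ymon12 i j : coprime_mnm (Y1 i) (Y2 j).
Proof.
apply: expo_coprime => e; rewrite expo_Ymon1 expo_Ymon2.
by case: e => [k c|k|k]; auto; case: (odd k.+1); auto.
Qed.

Lemma coprime_Ymon21 i j : coprime_mnm (Y2 i) (Y1 j).
Proof. exact/coprime_mnm_sym/coprime_Ymon12. Qed.

Lemma coprime_Ymon1U i : coprime_mnm (Y1 i) U.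
Proof.
by apply: expo_coprime => -[k c|k|k]; rewrite expo_Ymon1 expo_Umon; auto.
Qed.

Lemma coprime_Ymon2U i : coprime_mnm (Y2 i) U.
Proof.
by apply: expo_coprime => -[k c|k|k]; rewrite expo_Ymon2 expo_Umon; auto.
Qed.

End Factors.

(** [coprime_mnmD] comes last, as it also matches [U] through its definition. *)
Definition coprimeE := (coprime_Ymon12, coprime_Ymon21, coprime_Ymon1U,
  coprime_Ymon2U, coprime_Ymon1, coprime_Ymon2, coprime_mnmD).

(** * Initial monomials of toric ideals *)

Section ToricInitial.

Import GRing.Theory.
Local Open Scope ring_scope.

Variables (K : fieldType) (V E : finType) (ends : E -> {set V}).
Implicit Types (m u v : 'X_{1..#|E|}) (x : V).

Definition incidence m x : nat := (\sum_(e | x \in ends e) expo m e)%N.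

Definition toric_image m : 'X_{1..#|V|} :=
  (\sum_(i < #|E|) (\sum_(x in ends (enum_val i)) mvar x) *+ m i)%MM.

Lemma expo_toric_image m x : expo (toric_image m) x = incidence m x.
Proof.
rewrite expo_sum [RHS]big_mkcond.
rewrite (reindex_onto enum_rank enum_val) /=; last first.
  by move=> i _; rewrite enum_valK.
apply: eq_big => [e|e _]; rewrite enum_rankK ?eqxx //.
rewrite /expo mulmnE -/(expo _ x) expo_sum -/(expo m e).
under eq_bigr do rewrite expo_mvar.
case: ifPn => xe; last first.
  by rewrite big1 ?mul0n // => y; case: eqP => // -> /(negP xe).
rewrite (bigD1 x) //= eqxx big1 ?mul1n // => y /andP[_ /negPf->] //.
Qed.

Lemma toric_imageP u v :
  toric_image u = toric_image v <-> incidence u =1 incidence v.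
Proof.
split=> [uv x|uv]; first by rewrite -!expo_toric_image uv.
by apply: expoP => x; rewrite !expo_toric_image.
Qed.

Lemma mmap1_toric_image m :
  mmap1 (fun i => \prod_(x in ends (enum_val i)) 'X_[K, mvar x]) m
  = 'X_[K, toric_image m].
Proof.
rewrite /mmap1 /toric_image -mprodXnE.
by apply: eq_bigr => i _; rewrite mprodXE.
Qed.

Lemma mcoeff_toric_map p (w : 'X_{1..#|V|}) :
  (toric_map ends p : {mpoly K[#|V|]})@_w
  = \sum_(m <- msupp p | toric_image m == w) p@_m.
Proof.
rewrite /toric_map /mmap raddf_sum /= [RHS]big_mkcond.
apply: eq_bigr => m _; rewrite mmap1_toric_image mcoeffCM mcoeffX.
by case: eqP; rewrite ?mulr1 ?mulr0.
Qed.

Lemma toric_ideal_binomial u v :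
  toric_image u = toric_image v -> toric_ideal K ends ('X_[u] - 'X_[v]).
Proof.
move=> uv; rewrite /toric_ideal /toric_map mmapB !mmapX !mmap1_toric_image.
by rewrite uv subrr.
Qed.

(** The coefficients of an element of a toric ideal sum to zero over each fibre
    of [toric_image], so no fibre meets the support in a single monomial. *)
Lemma toric_ideal_fibre p m :
  toric_ideal K ends p -> m \in msupp p ->
  exists m', [/\ m' \in msupp p, m' != m & toric_image m' = toric_image m].
Proof.
move=> Ip mp; have := mcoeff_toric_map p (toric_image m).
rewrite [toric_map _ _]Ip mcoeff0.
have [/hasP[m' m'p /andP[nm /eqP im]] _|/hasPn no] :=
    boolP (has (fun m' => (m' != m) && (toric_image m' == toric_image m))
             (msupp p)).
  by exists m'.
rewrite -big_filter (bigD1_seq m) /=; last 2 first.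
- by rewrite mem_filter eqxx.
- exact/filter_uniq/msupp_uniq.
rewrite big_seq_cond big1 ?addr0 => [/eqP|m' /andP[]].
  by rewrite eq_sym mcoeff_eq0 mp.
by rewrite mem_filter => /andP[im m'p] nm; have := no _ m'p; rewrite nm im.
Qed.

Lemma toric_initial_fibre (prec : rel 'X_{1..#|E|}) p m :
  toric_ideal K ends p -> is_initial_monomial prec p m ->
  exists2 m', prec m' m & incidence m' =1 incidence m.
Proof.
move=> Ip [mp maxm]; have [m' [m'p nm im]] := toric_ideal_fibre Ip mp.
by exists m'; [apply: maxm | apply/toric_imageP].
Qed.

Lemma toric_initial_binomial (prec : rel 'X_{1..#|E|}) u v :
  u != v -> prec u v -> incidence u =1 incidence v ->
  exists2 p, toric_ideal K ends p & is_initial_monomial prec p v.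
Proof.
move=> nuv uv /toric_imageP im; exists ('X_[v] - 'X_[u]).
  exact: toric_ideal_binomial.
split=> [|m']; first by rewrite mcoeff_msupp mcoeffB !mcoeffX eqxx
  (negPf nuv) subr0 oner_eq0.
move/msuppB_le; rewrite mem_cat !msuppX !inE => /orP[->//|/eqP-> _ //].
Qed.

End ToricInitial.

Section Vertices.

Variables (l s t h : nat).
Local Notation edge := (Bedge l s t h).
Local Notation vert := (Bvert l s t h).
Local Notation inc := (incidence (@Bends l s t h)).
Implicit Types (m : 'X_{1..#|{: edge}|}).

Lemma eq_Be i j i' j' :
  (Be i j == Be i' j' :> edge) = (i == i' :> nat) && (j == j').
Proof. by []. Qed.

Lemma eq_Bf i i' : (Bf i == Bf i' :> edge) = (i == i' :> nat).
Proof. by []. Qed.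

Lemma eq_Bg i i' : (Bg i == Bg i' :> edge) = (i == i' :> nat).
Proof. by []. Qed.

Lemma path_vertex_BX j n k c :
  (path_vertex l s t j n == BX k c :> vert) = (n == k.+1) && (j == c).
Proof.
case: n => [|n] //=; rewrite eqSS; case: insubP => [k' _ <-|nk].
  by apply/eqP/andP => [[-> ->]|[/eqP/val_inj-> /eqP->]].
by case: (n =P k :> nat) nk => [->|_ _ //]; rewrite ltn_ord.
Qed.

Lemma path_vertex_By1 j n : (path_vertex l s t j n == By1 :> vert) = (n == 0).
Proof. by case: n => [|n] //=; case: insubP. Qed.

Lemma path_vertex_By2 j n :
  0 < l -> (path_vertex l s t j n == By2 :> vert) = (2 * l <= n).
Proof.
move=> l_gt0; case: n => [|n] /=.
  by rewrite leqn0 muln_eq0 (gtn_eqF l_gt0).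
by case: insubP => [k kn _|kn]; rewrite ?eqxx; [rewrite -[LHS]/false|]; lia.
Qed.

Lemma path_vertex_Bz j n k : (path_vertex l s t j n == Bz k :> vert) = false.
Proof. by case: n => [|n] //=; case: insubP. Qed.

Lemma path_vertex_Bw j n k : (path_vertex l s t j n == Bw k :> vert) = false.
Proof. by case: n => [|n] //=; case: insubP. Qed.

Lemma zcycle_vertex_Bz n k :
  (zcycle_vertex l s t h n == Bz k :> vert) = (n == k.+1).
Proof.
case: n => [|n] //=; rewrite eqSS; case: insubP => [k' _ <-|nk].
  by apply/eqP/eqP => [[->]|/val_inj->].
by case: (n =P k :> nat) nk => [->|_ _ //]; rewrite ltn_ord.
Qed.

Lemma zcycle_vertex_By1 n :
  (zcycle_vertex l s t h n == By1 :> vert) = (n == 0) || (2 * s < n).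
Proof.
case: n => [|n] //=.
by case: insubP => [k kn _|kn]; rewrite ?eqxx; [rewrite -[LHS]/false|]; lia.
Qed.

Lemma zcycle_vertex_other n (v : vert) :
  match v with By1 | Bz _ => false | _ => true end ->
  (zcycle_vertex l s t h n == v) = false.
Proof. by case: n => [|n] /=; [|case: insubP => [k _ _|_]]; case: v. Qed.

Lemma wcycle_vertex_Bw n k :
  (wcycle_vertex l s t h n == Bw k :> vert) = (n == k.+1).
Proof.
case: n => [|n] //=; rewrite eqSS; case: insubP => [k' _ <-|nk].
  by apply/eqP/eqP => [[->]|/val_inj->].
by case: (n =P k :> nat) nk => [->|_ _ //]; rewrite ltn_ord.
Qed.

Lemma wcycle_vertex_By2 n :
  (wcycle_vertex l s t h n == By2 :> vert) = (n == 0) || (2 * t < n).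
Proof.
case: n => [|n] //=.
by case: insubP => [k kn _|kn]; rewrite ?eqxx; [rewrite -[LHS]/false|]; lia.
Qed.

Lemma wcycle_vertex_other n (v : vert) :
  match v with By2 | Bw _ => false | _ => true end ->
  (wcycle_vertex l s t h n == v) = false.
Proof. by case: n => [|n] /=; [|case: insubP => [k _ _|_]]; case: v. Qed.

Lemma mem_Bends (v : vert) (e : edge) :
  (v \in Bends e) = match e with
    | Be i j => (path_vertex l s t j i == v) || (path_vertex l s t j i.+1 == v)
    | Bf i => (zcycle_vertex l s t h i == v) || (zcycle_vertex l s t h i.+1 == v)
    | Bg i => (wcycle_vertex l s t h i == v) || (wcycle_vertex l s t h i.+1 == v)
    end.
Proof. by case: e => *; rewrite !inE; congr (_ || _); rewrite eq_sym. Qed.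

Lemma big_Bedge (P : pred edge) (F : edge -> nat) :
  \sum_(e | P e) F e
  = \sum_j \sum_(i | P (Be i j)) F (Be i j) + \sum_(i | P (Bf i)) F (Bf i)
    + \sum_(i | P (Bg i)) F (Bg i).
Proof.
rewrite big_mkcond (reindex (@Bedge_decode l s t h)) /=; last first.
  exists (@Bedge_code l s t h) => e _; last exact: Bedge_codeK.
  by case: e => [[[]|]|].
rewrite !big_sumType /=; congr (_ + _ + _); try by rewrite -big_mkcond.
under [RHS]eq_bigr do rewrite big_mkcond.
by rewrite exchange_big pair_bigA; apply: eq_bigr => -[].
Qed.

Lemma incidence_two m v (a b : edge) :
  a != b -> (forall e, (v \in Bends e) = (e == a) || (e == b)) ->
  inc m v = expo m a + expo m b.
Proof.
move=> nab vab; rewrite /incidence (bigD1 a) ?vab ?eqxx //=.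
rewrite (bigD1 b) /= ?vab ?eqxx ?orbT 1?eq_sym ?nab //.
rewrite big1 ?addn0 // => e; rewrite vab.
by case: (e == a); case: (e == b).
Qed.

Lemma incidence_BX m (i i' : 'I_(2 * l)) (k : 'I_(2 * l - 1)) j :
  i = k :> nat -> i' = k.+1 :> nat ->
  inc m (BX k j) = expo m (Be i j) + expo m (Be i' j).
Proof.
move=> ik i'k; apply: incidence_two => [|e].
  by apply/eqP => -[/(congr1 val) /=]; lia.
rewrite mem_Bends; case: e => [a b|a|a].
- rewrite !path_vertex_BX -andb_orl.
  by rewrite !eq_Be -andb_orl ik i'k eqSS orbC.
- by rewrite !zcycle_vertex_other.
- by rewrite !wcycle_vertex_other.
Qed.

Lemma incidence_Bz m (i i' : 'I_(2 * s + 1)) (k : 'I_(2 * s)) :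
  i = k :> nat -> i' = k.+1 :> nat ->
  inc m (Bz k) = expo m (Bf i) + expo m (Bf i').
Proof.
move=> ik i'k; apply: incidence_two => [|e].
  by apply/eqP => -[/(congr1 val) /=]; lia.
rewrite mem_Bends; case: e => [a b|a|a].
- by rewrite !path_vertex_Bz.
- rewrite !zcycle_vertex_Bz eqSS orbC.
  by rewrite !eq_Bf ik i'k.
- by rewrite !wcycle_vertex_other.
Qed.

Lemma incidence_Bw m (i i' : 'I_(2 * t + 1)) (k : 'I_(2 * t)) :
  i = k :> nat -> i' = k.+1 :> nat ->
  inc m (Bw k) = expo m (Bg i) + expo m (Bg i').
Proof.
move=> ik i'k; apply: incidence_two => [|e].
  by apply/eqP => -[/(congr1 val) /=]; lia.
rewrite mem_Bends; case: e => [a b|a|a].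
- by rewrite !path_vertex_Bw.
- by rewrite !zcycle_vertex_other.
- rewrite !wcycle_vertex_Bw eqSS orbC.
  by rewrite !eq_Bg ik i'k.
Qed.

Lemma sum_val_pred1 n (P : pred 'I_n) (F : 'I_n -> nat) i :
  (forall k, P k = (k == i)) -> \sum_(k | P k) F k = F i.
Proof. by move=> Pi; rewrite (big_pred1 i). Qed.

Lemma sum_val_pred2 n (P : pred 'I_n) (F : 'I_n -> nat) i i' :
  i != i' -> (forall k, P k = (k == i) || (k == i')) ->
  \sum_(k | P k) F k = F i + F i'.
Proof.
move=> nii' Pi; rewrite (bigD1 i) ?Pi ?eqxx //=; congr (_ + _).
apply: sum_val_pred1 => k; rewrite Pi.
by case: (k =P i) nii' => [->|_] /= => [/negPf->|_]; rewrite ?andbT ?andbF.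
Qed.

Lemma incidence_By1 m (i : 'I_(2 * l)) (a b : 'I_(2 * s + 1)) :
  0 < s -> i = 0 :> nat -> a = 0 :> nat -> b = 2 * s :> nat ->
  inc m By1 = \sum_j expo m (Be i j) + expo m (Bf a) + expo m (Bf b).
Proof.
move=> s_gt0 i0 a0 b0; rewrite /incidence big_Bedge -[RHS]addnA -[RHS]addn0.
congr (_ + _ + _).
- apply: eq_bigr => j _; apply: sum_val_pred1 => k.
  by rewrite mem_Bends !path_vertex_By1 orbF -(inj_eq val_inj) /= i0.
- apply: sum_val_pred2 => [|k].
    by rewrite -(inj_eq val_inj) /= a0 b0; lia.
  rewrite mem_Bends !zcycle_vertex_By1 -!(inj_eq val_inj) /= a0 b0.
  by have := ltn_ord k; lia.
- by rewrite big1 // => k; rewrite mem_Bends !wcycle_vertex_other.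
Qed.

Lemma incidence_By2 m (i : 'I_(2 * l)) (a b : 'I_(2 * t + 1)) :
  0 < l -> 0 < t -> i.+1 = 2 * l :> nat -> a = 0 :> nat -> b = 2 * t :> nat ->
  inc m By2 = \sum_j expo m (Be i j) + expo m (Bg a) + expo m (Bg b).
Proof.
move=> l_gt0 t_gt0 i0 a0 b0; rewrite /incidence big_Bedge.
rewrite [X in _ + X + _]big1 ?addn0 => [|k]; last first.
  by rewrite mem_Bends !zcycle_vertex_other.
rewrite -[RHS]addnA; congr (_ + _).
- apply: eq_bigr => j _; apply: sum_val_pred1 => k.
  rewrite mem_Bends !path_vertex_By2 // -(inj_eq val_inj) /=.
  by have := ltn_ord k; lia.
- apply: sum_val_pred2 => [|k].
    by rewrite -(inj_eq val_inj) /= a0 b0; lia.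
  rewrite mem_Bends !wcycle_vertex_By2 -!(inj_eq val_inj) /= a0 b0.
  by have := ltn_ord k; lia.
Qed.

End Vertices.

(** * The initial ideal *)

Lemma sum_incidence (V E : finType) (ends : E -> {set V}) (m : 'X_{1..#|E|}) :
  simple_graph ends -> \sum_v incidence ends m v = 2 * mdeg m.
Proof.
case=> _ card2; rewrite (exchange_big_dep predT) //= mdegE big_distrr /=.
rewrite [RHS](reindex enum_rank) /=; last first.
  by exists enum_val => x _; rewrite ?enum_rankK ?enum_valK.
by apply: eq_bigr => e _; rewrite sum_nat_const card2.
Qed.

Lemma filter_enum_last n (P : pred 'I_n) (x : 'I_n) :
  x.+1 = n -> P x -> exists r, [seq i <- enum 'I_n | P i] = rcons r x.
Proof.
case: n P x => [|n] P x; first by case: x.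
move=> [xn] Px; have -> : x = ord_max by apply: val_inj.
by rewrite enum_ordSr filter_rcons -(val_inj (xn : _ = val ord_max)) Px; eexists.
Qed.

Section InitialIdeal.

Variables (l s t h : nat).
Hypotheses (l_gt0 : 0 < l) (s_gt0 : 0 < s) (t_gt0 : 0 < t).
Local Notation edge := (Bedge l s t h).
Local Notation vert := (Bvert l s t h).
Local Notation inc := (incidence (@Bends l s t h)).
Local Notation Y1 := (@Ymon1 l s t h).
Local Notation Y2 := (@Ymon2 l s t h).
Local Notation U := (@Umon l s t h).
Local Notation V := (@Vmon l s t h).
Local Notation prec := (grevlex (Bvars l s t h)).
Implicit Types (m : 'X_{1..#|{: edge}|}).

(** Distinct monomials with the same image differ on the last edge of some path,
    and these last edges are the [h] smallest variables, in the order of the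
    paths.  Nothing else about the order of the variables matters. *)
Lemma index_Bvars : exists N, forall y : edge,
  match y with
  | Be k c => if k.+1 == 2 * l then index y (Bvars l s t h) = N + c
              else index y (Bvars l s t h) < N
  | _ => index y (Bvars l s t h) < N
  end.
Proof.
have ltlast : (2 * l).-1 < 2 * l by lia.
pose z := Ordinal ltlast; have zl : z.+1 = 2 * l by rewrite /=; lia.
have even_z : ~~ odd z.+1 by rewrite zl oddM.
have [r rz] := filter_enum_last (P := fun i => ~~ odd i.+1) zl even_z.
have : uniq (rcons r z) by rewrite -rz filter_uniq ?enum_uniq.
rewrite rcons_uniq => /andP[z_r _].
pose A := [seq Be i j : edge |
  i <- [seq i : 'I_(2 * l) <- enum 'I_(2 * l) | odd i.+1], j <- enum 'I_h].
pose B := A ++ [seq Bg i : edge | i <- enum 'I_(2 * t + 1)]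
     ++ [seq Bf i : edge | i <- enum 'I_(2 * s + 1)]
     ++ [seq Be i j : edge | i <- r, j <- enum 'I_h].
have BE : Bvars l s t h = B ++ [seq Be z j : edge | j <- enum 'I_h].
  by rewrite /Bvars rz map_rcons flatten_rcons /B -!catA.
exists (size B) => y; rewrite BE index_cat.
have ltB : y \in B -> (if y \in B then index y B
    else size B + index y [seq Be z j : edge | j <- enum 'I_h]) < size B.
  by move=> yB; rewrite yB index_mem.
case: y ltB => [k c|k|k] ltB.
- case: eqP => [kl|/eqP kl]; last first.
    apply: ltB; rewrite !mem_cat; case: (boolP (odd k.+1)) => ok.
      by apply/orP; left; apply/allpairsP; exists (k, c);
        rewrite mem_filter ok !mem_enum.
    apply/orP; right; apply/orP; right; apply/orP; right.
    apply/allpairsP; exists (k, c); rewrite !mem_enum /=; split=> //.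
    have : k \in rcons r z by rewrite -rz mem_filter ok mem_enum.
    by rewrite mem_rcons inE => /orP[/eqP kz|//]; rewrite kz zl eqxx in kl.
  have {kl}-> : k = z by apply: val_inj; rewrite /=; lia.
  rewrite index_map; last by move=> ? ? [].
  rewrite index_enum_ord ifN // !mem_cat; apply/norP; split.
    apply/allpairsP => -[[i j] /= [+ _ [zi _]]].
    by rewrite -zi mem_filter => /andP[+ _]; apply/negP.
  apply/norP; split; first by apply/mapP => -[].
  apply/norP; split; first by apply/mapP => -[].
  by apply/allpairsP => -[[i j] /= [ir _ [zi _]]]; rewrite zi ir in z_r.
- by apply: ltB; rewrite !mem_cat (map_f (@Bf l s t h)) ?mem_enum ?orbT.
- by apply: ltB; rewrite !mem_cat (map_f (@Bg l s t h)) ?mem_enum ?orbT.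
Qed.

Lemma grevlex_last u v (z : 'I_(2 * l)) j :
  z.+1 = 2 * l -> mdeg u = mdeg v ->
  expo v (Be z j) < expo u (Be z j) ->
  (forall c : 'I_h, j < c -> expo u (Be z c) = expo v (Be z c)) ->
  prec u v.
Proof.
move=> zl deg lt_j eq_c; rewrite /grevlex deg eqxx orbC /=.
apply/orP; left; apply/existsP; exists (Be z j); rewrite [X in X && _]lt_j /=.
apply/forallP => y; apply/implyP; have [N NP] := index_Bvars.
have := NP (Be z j); rewrite zl eqxx => ->; have := NP y.
have below a : a < N -> N + j < a -> false by lia.
case: y => [k c|k|k]; last 2 first.
- by move=> yN /(below _ yN).
- by move=> yN /(below _ yN).
case: eqP => [kl|_]; last by move=> yN /(below _ yN).
have -> : k = z by apply: val_inj; apply: succn_inj; rewrite /= kl.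
by move=> ->; rewrite ltn_add2l => /eq_c /eqP.
Qed.

Lemma incidenceD u v x : inc (u + v)%MM x = inc u x + inc v x.
Proof. by rewrite -big_split; apply: eq_bigr => e _; rewrite expoD. Qed.

Lemma BX_edges (k : 'I_(2 * l - 1)) c :
  exists i i' : 'I_(2 * l), [/\ i = k :> nat, i' = k.+1 :> nat
    & forall m, inc m (BX k c) = expo m (Be i c) + expo m (Be i' c)].
Proof.
have k1 : k < 2 * l by have := ltn_ord k; lia.
have k2 : k.+1 < 2 * l by have := ltn_ord k; lia.
by exists (Ordinal k1), (Ordinal k2); split=> // m; apply: incidence_BX.
Qed.

Lemma Bz_edges (k : 'I_(2 * s)) :
  exists i i' : 'I_(2 * s + 1), [/\ i = k :> nat, i' = k.+1 :> nat
    & forall m, inc m (Bz k) = expo m (Bf i) + expo m (Bf i')].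
Proof.
have k1 : k < 2 * s + 1 by have := ltn_ord k; lia.
have k2 : k.+1 < 2 * s + 1 by have := ltn_ord k; lia.
by exists (Ordinal k1), (Ordinal k2); split=> // m; apply: incidence_Bz.
Qed.

Lemma Bw_edges (k : 'I_(2 * t)) :
  exists i i' : 'I_(2 * t + 1), [/\ i = k :> nat, i' = k.+1 :> nat
    & forall m, inc m (Bw k) = expo m (Bg i) + expo m (Bg i')].
Proof.
have k1 : k < 2 * t + 1 by have := ltn_ord k; lia.
have k2 : k.+1 < 2 * t + 1 by have := ltn_ord k; lia.
by exists (Ordinal k1), (Ordinal k2); split=> // m; apply: incidence_Bw.
Qed.

Lemma By1_edges :
  exists (i : 'I_(2 * l)) (a b : 'I_(2 * s + 1)),
  [/\ i = 0 :> nat, a = 0 :> nat, b = 2 * s :> nat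
    & forall m, inc m By1
      = \sum_j expo m (Be i j) + expo m (Bf a) + expo m (Bf b)].
Proof.
have i0 : 0 < 2 * l by lia.
have a0 : 0 < 2 * s + 1 by lia.
have b0 : 2 * s < 2 * s + 1 by lia.
exists (Ordinal i0), (Ordinal a0), (Ordinal b0).
by split=> // m; apply: incidence_By1.
Qed.

Lemma By2_edges :
  exists (i : 'I_(2 * l)) (a b : 'I_(2 * t + 1)),
  [/\ i.+1 = 2 * l :> nat, a = 0 :> nat, b = 2 * t :> nat
    & forall m, inc m By2
      = \sum_j expo m (Be i j) + expo m (Bg a) + expo m (Bg b)].
Proof.
have i0 : (2 * l).-1 < 2 * l by lia.
have a0 : 0 < 2 * t + 1 by lia.
have b0 : 2 * t < 2 * t + 1 by lia.
exists (Ordinal i0), (Ordinal a0), (Ordinal b0).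
have il : (Ordinal i0).+1 = 2 * l by rewrite /=; lia.
by split=> // m; apply: incidence_By2.
Qed.

Lemma sum_eq_nat (c : 'I_h) : \sum_j (c == j : nat) = 1.
Proof.
rewrite (bigD1 c) //= eqxx big1 // => j; rewrite eq_sym.
by case: eqP.
Qed.

Lemma incidence_Ymon1 j x :
  inc (Y1 j) x = match x with By1 => 1 | BX _ c => j == c : nat | _ => 0 end.
Proof.
case: x => [||k c|k|k].
- have [i [a [b [i0 _ _ ->]]]] := By1_edges; rewrite !expo_Ymon1 !addn0.
  by under eq_bigr do rewrite expo_Ymon1 i0 /=; apply: sum_eq_nat.
- have [i [a [b [il _ _ ->]]]] := By2_edges; rewrite !expo_Ymon1 !addn0.
  by apply: big1 => c _; rewrite expo_Ymon1 il oddM.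
- have [i [i' [ik i'k ->]]] := BX_edges k c; rewrite !expo_Ymon1 ik i'k /=.
  by case: (odd k); rewrite /= ?addn0.
- by have [i [i' [_ _ ->]]] := Bz_edges k; rewrite !expo_Ymon1.
- by have [i [i' [_ _ ->]]] := Bw_edges k; rewrite !expo_Ymon1.
Qed.

Lemma incidence_Ymon2 j x :
  inc (Y2 j) x = match x with By2 => 1 | BX _ c => j == c : nat | _ => 0 end.
Proof.
case: x => [||k c|k|k].
- have [i [a [b [i0 _ _ ->]]]] := By1_edges; rewrite !expo_Ymon2 !addn0.
  by apply: big1 => c _; rewrite expo_Ymon2 i0.
- have [i [a [b [il _ _ ->]]]] := By2_edges; rewrite !expo_Ymon2 !addn0.
  by under eq_bigr do rewrite expo_Ymon2 il oddM /=; apply: sum_eq_nat.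
- have [i [i' [ik i'k ->]]] := BX_edges k c; rewrite !expo_Ymon2 ik i'k /=.
  by case: (odd k); rewrite /= ?addn0.
- by have [i [i' [_ _ ->]]] := Bz_edges k; rewrite !expo_Ymon2.
- by have [i [i' [_ _ ->]]] := Bw_edges k; rewrite !expo_Ymon2.
Qed.

Lemma incidence_Umon x :
  inc U x = match x with By1 | BX _ _ => 0 | By2 => 2 | _ => 1 end.
Proof.
case: x => [||k c|k|k].
- have [i [a [b [_ a0 b0 ->]]]] := By1_edges; rewrite !expo_Umon a0 b0 /= oddM.
  by rewrite big1 // => j _; rewrite expo_Umon.
- have [i [a [b [_ a0 b0 ->]]]] := By2_edges; rewrite !expo_Umon a0 b0 /= oddM.
  by rewrite big1 // => j _; rewrite expo_Umon.
- by have [i [i' [_ _ ->]]] := BX_edges k c; rewrite !expo_Umon.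
- have [i [i' [ik i'k ->]]] := Bz_edges k; rewrite !expo_Umon ik i'k /=.
  by case: (odd k).
- have [i [i' [ik i'k ->]]] := Bw_edges k; rewrite !expo_Umon ik i'k /=.
  by case: (odd k).
Qed.

Lemma incidence_Vmon x :
  inc V x = match x with By2 | BX _ _ => 0 | By1 => 2 | _ => 1 end.
Proof.
case: x => [||k c|k|k].
- have [i [a [b [_ a0 b0 ->]]]] := By1_edges; rewrite !expo_Vmon a0 b0 /= oddM.
  by rewrite big1 // => j _; rewrite expo_Vmon.
- have [i [a [b [_ a0 b0 ->]]]] := By2_edges; rewrite !expo_Vmon a0 b0 /= oddM.
  by rewrite big1 // => j _; rewrite expo_Vmon.
- by have [i [i' [_ _ ->]]] := BX_edges k c; rewrite !expo_Vmon.
- have [i [i' [ik i'k ->]]] := Bz_edges k; rewrite !expo_Vmon ik i'k /=.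
  by case: (odd k).
- have [i [i' [ik i'k ->]]] := Bw_edges k; rewrite !expo_Vmon ik i'k /=.
  by case: (odd k).
Qed.

Lemma mem_Bpairs (p : 'I_h * 'I_h) : (p \in Bpairs h) = (p.1 < p.2).
Proof.
rewrite mem_filter andbC; case: allpairsP => // -[].
by exists p; rewrite !mem_rev !mem_enum; case: p.
Qed.

Lemma mem_Bgens1 (i j : 'I_h) : i < j -> (Y1 j + Y2 i)%MM \in Bgens l s t h.
Proof.
move=> ij; rewrite !mem_cat; apply/orP; left.
by apply/mapP; exists (i, j); rewrite ?mem_Bpairs.
Qed.

Lemma mem_Bgens2 (i j : 'I_h) :
  i <= j -> (Y1 j + Y1 i + U)%MM \in Bgens l s t h.
Proof.
move=> ij; rewrite !mem_cat; apply/orP; right; apply/orP.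
have [<-|ne] := eqVneq i j.
  by right; apply/mapP; exists i; rewrite ?mem_rev ?mem_enum.
left; apply/mapP; exists (i, j); rewrite ?mem_Bpairs //=.
by rewrite ltn_neqAle ij andbT.
Qed.

Lemma BgensP g :
  g \in Bgens l s t h ->
  (exists2 p : 'I_h * 'I_h, p.1 < p.2 & g = (Y1 p.2 + Y2 p.1)%MM) \/
  (exists2 p : 'I_h * 'I_h, p.1 <= p.2 & g = (Y1 p.2 + Y1 p.1 + U)%MM).
Proof.
rewrite !mem_cat => /or3P[] /mapP[p]; rewrite ?mem_Bpairs => lp ->.
- by left; exists p.
- by right; exists p => //; apply: ltnW.
- by right; exists (p, p).
Qed.

(** Two paths [i < j] form a closed even walk, with the binomial
    [Y1 j Y2 i - Y1 i Y2 j]; both odd cycles joined by the paths [i <= j] form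
    another one, with [Y1 j Y1 i U - Y2 j Y2 i V].  In both cases the term that
    trails is the one containing the last edge of path [j]. *)
Lemma Bgens_initial (K : fieldType) g : g \in Bgens l s t h ->
  exists2 p, toric_ideal K (@Bends l s t h) p & is_initial_monomial prec p g.
Proof.
have [z [_ [_ [zl _ _ _]]]] := By2_edges.
have oz : odd z.+1 = false by rewrite zl oddM.
move=> /BgensP[] [[i j] /= ij ->].
- have lt_j : expo (Y1 j + Y2 i)%MM (Be z j : edge)
              < expo (Y1 i + Y2 j)%MM (Be z j : edge).
    rewrite !expoD !expo_Ymon1 !expo_Ymon2 oz /= eqxx.
    by rewrite -(inj_eq val_inj) /= ltn_eqF.
  apply: (@toric_initial_binomial _ _ _ _ _ (Y1 i + Y2 j)%MM).
  + by apply/eqP => uv; rewrite uv ltnn in lt_j.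
  + apply: (grevlex_last zl _ lt_j) => [|c jc].
      by rewrite !mdegD !mdeg_Ymon1 !mdeg_Ymon2.
    rewrite !expoD !expo_Ymon1 !expo_Ymon2 oz /= -!(inj_eq val_inj) /=.
    by rewrite !ltn_eqF // (ltn_trans ij).
  + move=> x; rewrite !incidenceD !incidence_Ymon1 !incidence_Ymon2.
    by case: x => // *; rewrite addnC.
- have lt_j : expo (Y1 j + Y1 i + U)%MM (Be z j : edge)
              < expo (Y2 j + Y2 i + V)%MM (Be z j : edge).
    rewrite (expoD _ U) (expoD _ V) !(expoD (Y1 _)) !(expoD (Y2 _)).
    rewrite !expo_Ymon1 !expo_Ymon2 expo_Umon expo_Vmon oz /= eqxx.
    by case: (i == j).
  apply: (@toric_initial_binomial _ _ _ _ _ (Y2 j + Y2 i + V)%MM).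
  + by apply/eqP => uv; rewrite uv ltnn in lt_j.
  + apply: (grevlex_last zl _ lt_j) => [|c jc].
      rewrite (mdegD _ U) (mdegD _ V) !(mdegD (Y1 _)) !(mdegD (Y2 _)).
      by rewrite !mdeg_Ymon1 !mdeg_Ymon2 mdeg_Umon mdeg_Vmon.
    rewrite (expoD _ U) (expoD _ V) !(expoD (Y1 _)) !(expoD (Y2 _)).
    rewrite !expo_Ymon1 !expo_Ymon2 expo_Umon expo_Vmon.
    rewrite oz /= -!(inj_eq val_inj) /=.
    by rewrite !ltn_eqF // (leq_ltn_trans ij).
  + move=> x; rewrite (incidenceD _ U) (incidenceD _ V).
    rewrite !(incidenceD (Y1 _)) !(incidenceD (Y2 _)).
    by rewrite !incidence_Ymon1 !incidence_Ymon2 incidence_Umon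
      incidence_Vmon; case: x.
Qed.

End InitialIdeal.

Lemma alternating n (F : 'I_n -> int) (z : 'I_n) :
  z = 0 :> nat ->
  (forall i i' : 'I_n, i' = i.+1 :> nat -> F i' = - F i)%R ->
  forall i : 'I_n, F i = (if odd i then - F z else F z)%R.
Proof.
move=> z0 alt i; case: i => i; elim: i => [|i IHi] ilt.
  by rewrite /=; congr (F _); apply: val_inj; rewrite /= z0.
rewrite (alt (Ordinal (ltnW ilt)) (Ordinal ilt)) // IHi /=.
by case: (odd i); rewrite ?GRing.opprK.
Qed.

Section Fibres.

Import Order.TTheory GRing.Theory Num.Theory.

Variables (l s t h : nat).
Hypotheses (l_gt0 : 0 < l) (s_gt0 : 0 < s) (t_gt0 : 0 < t).
Local Notation edge := (Bedge l s t h).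
Local Notation inc := (incidence (@Bends l s t h)).
Local Notation Y1 := (@Ymon1 l s t h).
Local Notation Y2 := (@Ymon2 l s t h).
Local Notation U := (@Umon l s t h).
Local Notation prec := (grevlex (Bvars l s t h)).
Implicit Types (u v : 'X_{1..#|{: edge}|}).

Definition diff u v (e : edge) : int := ((expo u e)%:Z - (expo v e)%:Z)%R.

(** At a vertex of degree two the exponents of the two edges change by opposite
    amounts, so a difference of two monomials in one fibre alternates along each
    path and each cycle; the last equation is the balance at [y_1] and [y_2]. *)
Lemma fibre_diff u v : inc u =1 inc v ->
  exists (a : 'I_h -> int) (c : int),
  [/\ forall i j, diff u v (Be i j) = (if odd i then - a j else a j)%R,
      forall i, diff u v (Bf i) = (if odd i then c else - c)%R,
      forall i, diff u v (Bg i) = (if odd i then - c else c)%R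
    & (\sum_j a j = c + c)%R].
Proof.
move=> uv; pose d := diff u v.
have [y1 [f0 [f1 [y10 f00 f1s inc1]]]] := By1_edges h l_gt0 s_gt0 t_gt0.
have [y2 [g0 [g1 [y2l g00 g1t inc2]]]] := By2_edges h l_gt0 s_gt0 t_gt0.
have dB (j : 'I_h) := @alternating _ (fun i => d (Be i j)) y1 y10.
have {}dB i j : d (Be i j) = (if odd i then - d (Be y1 j) else d (Be y1 j))%R.
  apply: dB => {}i i' ii'.
  have k1 : i < 2 * l - 1 by have := ltn_ord i'; lia.
  have := uv (BX (Ordinal k1) j).
  rewrite !(incidence_BX _ (i := i) (i' := i')) //.
  rewrite /d /diff; lia.
have dF i : d (Bf i) = (if odd i then - d (Bf f0) else d (Bf f0))%R.
  apply: (alternating (F := fun i => d (Bf i))) => // {}i i' ii'.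
  have k1 : i < 2 * s by have := ltn_ord i'; lia.
  have := uv (Bz (Ordinal k1)).
  rewrite !(incidence_Bz _ (i := i) (i' := i')) //.
  rewrite /d /diff; lia.
have dG i : d (Bg i) = (if odd i then - d (Bg g0) else d (Bg g0))%R.
  apply: (alternating (F := fun i => d (Bg i))) => // {}i i' ii'.
  have k1 : i < 2 * t by have := ltn_ord i'; lia.
  have := uv (Bw (Ordinal k1)).
  rewrite !(incidence_Bw _ (i := i) (i' := i')) //.
  rewrite /d /diff; lia.
have sumd i : (\sum_j d (Be i j) =
    (\sum_j expo u (Be i j))%:Z - (\sum_j expo v (Be i j))%:Z)%R.
  by rewrite !(big_morph Posz PoszD (erefl _)) -sumrB.
exists (fun j => d (Be y1 j)), (d (Bg g0)).
have sum1 : (\sum_j d (Be y1 j) + d (Bf f0) + d (Bf f0) = 0)%R.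
  have := dF f1; rewrite f1s oddM /= => {2}<-; rewrite sumd.
  have := uv By1; rewrite !inc1 /d /diff; lia.
have sum2 : (\sum_j d (Be y1 j) = d (Bg g0) + d (Bg g0))%R.
  have : (\sum_j d (Be y2 j) + d (Bg g0) + d (Bg g0) = 0)%R.
    have := dG g1; rewrite g1t oddM /= => {2}<-; rewrite sumd.
    have := uv By2; rewrite !inc2 /d /diff; lia.
  have odd2 : odd y2 by have := congr1 odd y2l; rewrite /= oddM /=; case: odd.
  under eq_bigr do rewrite dB odd2.
  by rewrite sumrN -addrA addrC => /eqP; rewrite subr_eq0 => /eqP.
split=> // i; rewrite -/d dF; case: (odd i); lia.
Qed.

(** Let [J] be the path of largest index on which [m] and [m'] differ.  As [m']
    is smaller, [a J > 0] in the notation of [fibre_diff], so [Y1 J] divides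
    [m].  Either some path [i] has [a i < 0], whence [Y2 i] divides [m]; or all
    [a i] are nonnegative with an even positive sum, whence [U] divides [m] and
    a second factor [Y1 i] is available, possibly [Y1 J] again. *)
Lemma fibre_divisible m m' : prec m' m -> inc m' =1 inc m ->
  exists2 g, g \in Bgens l s t h & (g <= m)%MM.
Proof.
move=> lt_m' im; have [a [c [dB dF dG suma]]] := fibre_diff (fsym im).
have deg : mdeg m' = mdeg m.
  have S := Bgraph_simple h l_gt0 s_gt0 t_gt0.
  have : \sum_v inc m' v = \sum_v inc m v by apply: eq_bigr.
  by rewrite !sum_incidence // !mul2n => /double_inj.
move: lt_m'; rewrite /grevlex deg ltnn eqxx /=.
case/existsP=> x /andP[ltx /forallP gtx].
have {ltx} dx : (diff m m' x < 0)%R by rewrite subr_lt0 ltz_nat.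
have {gtx} dy y : index x (Bvars l s t h) < index y (Bvars l s t h) ->
    diff m m' y = 0%R.
  by move=> xy; have := gtx y; rewrite xy /diff /expo => /eqP ->; rewrite subrr.
have ge_d e : (diff m m' e <= (expo m e)%:Z)%R by rewrite /diff; lia.
have ge0 e : (0 <= (expo m e)%:Z)%R by [].
have [[j0 nz0]|a0] : (exists j, a j != 0%R) \/ (forall j, a j = 0%R).
  case: (boolP [exists j, a j != 0%R]) => [/existsP|/existsPn a0]; first by left.
  by right=> j; apply/eqP; rewrite -[_ == _]negbK.
(* Without a nonzero [a j] the two monomials would coincide. *)
2: { have c0 : c = 0%R by move: suma; rewrite big1 //; lia.
     move: dx; case: x {dy} => [i j|i|i]; rewrite ?dB ?dF ?dG ?a0 ?c0;
       by case: (odd i). }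
have [J nzJ maxJ] := @arg_maxnP _ j0 (fun j => a j != 0%R) val nz0.
(* Were [a J] negative, the smallest variable on which the monomials differ
   would be the last edge of path [J], and [m'] would be the larger one. *)
have {nz0 j0} aJ : (0 < a J)%R.
  rewrite lt0r nzJ leNgt; apply/negP => aJ.
  have [z [_ [_ [zl _ _ _]]]] := By2_edges h l_gt0 s_gt0 t_gt0.
  have oz : odd z by have := congr1 odd zl; rewrite /= oddM /=; case: odd.
  have [N NP] := index_Bvars h l_gt0 s_gt0 t_gt0.
  have zJ : index (Be z J) (Bvars l s t h) = N + J.
    by have := NP (Be z J); rewrite zl eqxx.
  have dzJ := dB z J; rewrite oz in dzJ.
  have below : index x (Bvars l s t h) < N + J -> False.
    by rewrite -zJ => /dy; lia.
  have := NP x; case: x dx dy below => [k j|k|k] dx dy below; last 2 first.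
  - by move=> xN; apply: below; rewrite (leq_trans xN) ?leq_addr.
  - by move=> xN; apply: below; rewrite (leq_trans xN) ?leq_addr.
  case: eqP => [kl xN|_ xN]; last first.
    by apply: below; rewrite (leq_trans xN) ?leq_addr.
  have ek : k = z by apply: val_inj; apply: succn_inj; rewrite /= kl.
  move: dx below; rewrite xN ek dB oz ltn_add2l => dx below.
  have : (j : nat) <= J by apply: maxJ; apply/eqP => aj; rewrite aj in dx.
  rewrite leq_eqVlt => /orP[/eqP/val_inj jJ|/below//].
  by move: dx; rewrite jJ; lia.
have [[i ai]|a_ge0] : (exists i, (a i < 0)%R) \/ (forall i, (0 <= a i)%R).
  case: (boolP [exists j, (a j < 0)%R]) => [/existsP|/existsPn a0]; first by left.
  by right=> j; have := a0 j; rewrite -leNgt.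
- have iJ : i < J.
    have : (i : nat) <= J by apply: maxJ; rewrite lt_eqF.
    rewrite leq_eqVlt => /orP[/eqP/val_inj ij|//].
    by move: ai; rewrite ij; lia.
  exists (Y1 J + Y2 i)%MM; first exact: mem_Bgens1.
  apply/expo_lepP => e; rewrite expoD expo_Ymon1 expo_Ymon2.
  have := ge_d e; have := ge0 e; case: e => [k j|k|k] //; rewrite dB /=.
  case: (odd k) => /=; last by case: eqP => [<-|_]; lia.
  by case: eqP => [<-|_]; lia.
have sumJ j : j != J -> (a J + a j <= c + c)%R.
  move=> nj; rewrite -suma (bigD1 J) //= (bigD1 j) //= addrA lerDl.
  exact: sumr_ge0.
have c_gt0 : (0 < c)%R.
  suff : (a J <= c + c)%R by lia.
  by rewrite -suma (bigD1 J) //= lerDl; apply: sumr_ge0.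
(* [a J = 1] alone cannot make the even sum [c + c]. *)
have [i [ij ai aiJ]] : exists i : 'I_h,
    [/\ i <= J, (0 < a i)%R & i = J -> (1 < a J)%R].
  have [a1|a1] := ltP 1%R (a J); first by exists J.
  case: (boolP [exists i, (i != J) && (0 < a i)%R]) => [/existsP[i /andP[nij ai]]|].
    exists i; split=> // [|ij]; last by rewrite ij eqxx in nij.
    by apply: maxJ; rewrite gt_eqF.
  move/existsPn => no; have : (\sum_j a j = a J)%R.
    rewrite (bigD1 J) //= big1 ?addr0 // => i ni.
    by have := no i; have := a_ge0 i; rewrite ni /=; lia.
  rewrite suma; lia.
exists (Y1 J + Y1 i + U)%MM; first exact: mem_Bgens2.
apply/expo_lepP => e; rewrite (expoD _ U) expoD !expo_Ymon1 expo_Umon.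
have := ge_d e; have := ge0 e; case: e => [k j|k|k].
- rewrite dB /=; case: (odd k) => /=; first by lia.
  case: eqP => [<-|nJ]; case: eqP => [iJ|ni] //; try lia.
    by have := aiJ iJ; lia.
  by rewrite -iJ; lia.
- by rewrite dF /=; case: (odd k) => /=; lia.
- by rewrite dG /=; case: (odd k) => /=; lia.
Qed.

Theorem initial_ideal_Bgens (K : fieldType) :
  same_ideal (initial_ideal prec (toric_ideal K (@Bends l s t h)))
    (mon_ideal (Bgens l s t h)).
Proof.
apply: initial_ideal_monomials => [p m Ip inp|g]; last exact: Bgens_initial.
have [m' lt_m' im] := toric_initial_fibre Ip inp.
exact: fibre_divisible lt_m' im.
Qed.

End Fibres.

(** * Colon ideals *)

(** For a list strictly sorted by [r], the entries before a given one are told by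
    [r] alone.  This replaces positions in the list of generators by comparisons
    of indices. *)
Lemma mem_take_pairwise (T : eqType) (r : rel T) (x0 x : T) (s : seq T) k :
  (forall x y, r x y -> ~~ r y x) -> pairwise r s -> k < size s ->
  (x \in take k s) = (x \in s) && r x (nth x0 s k).
Proof.
move=> asym; rewrite -{1 4}(cat_take_drop k s) => rs ks; move: rs.
rewrite (drop_nth x0) // pairwise_cat /= => /and3P[/allrelP before _].
set y := nth x0 s k in before * => /andP[/allP after _].
rewrite mem_cat inE; apply/idP/andP => [xk|[/or3P[//|/eqP->|xd] rxy]].
- by rewrite xk before // mem_head.
- by have := asym y y rxy; rewrite rxy.
- by have := asym _ _ rxy; rewrite after.
Qed.

Lemma pairwise_allpairs (S T : eqType) (r1 : rel S) (r2 : rel T)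
    (s : seq S) (u : seq T) :
  pairwise r1 s -> pairwise r2 u ->
  pairwise (fun p q => r1 p.1 q.1 || (p.1 == q.1) && r2 p.2 q.2)
    [seq (x, y) | x <- s, y <- u].
Proof.
move=> + r2u; elim: s => //= x s IHs /andP[/allP rx rs].
rewrite pairwise_cat IHs // andbT; apply/andP; split.
  apply/allrelP => _ _ /mapP[y _ ->] /allpairsP[[x' y'] /= [x's _ ->]] /=.
  by rewrite rx.
rewrite pairwise_map; apply: sub_pairwise r2u => y y' /= ->.
by rewrite eqxx orbT.
Qed.

Lemma pairwise_map_uniq (T S : eqType) (f : T -> S) (r : rel S) (s : seq T) :
  uniq s -> {in s &, forall x y, x != y -> r (f x) (f y)} ->
  pairwise r [seq f x | x <- s].
Proof.
rewrite uniq_pairwise pairwise_map => us rf.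
by apply: (sub_in_pairwise (P := mem s) _ _ us); [exact: rf|apply/allP].
Qed.

Lemma count_enum_ord n (p : pred nat) :
  count (fun i : 'I_n => p i) (enum 'I_n) = count p (iota 0 n).
Proof. by rewrite -val_enum_ord count_map. Qed.

Lemma count_iota_interval n a b :
  count (fun i => a <= i < b) (iota 0 n) = minn b n - a.
Proof.
elim: n => [|n IHn]; first by rewrite minn0.
rewrite -addn1 iotaD count_cat IHn /= addn0; lia.
Qed.

Lemma count_iota_above n a b :
  count (fun i => (a <= i) && (i != b)) (iota 0 n) = n - a - (a <= b < n).
Proof.
elim: n => [|n IHn] //.
rewrite -addn1 iotaD count_cat IHn /= addn0; lia.
Qed.

Lemma gt_ord_neq n (a b : 'I_n) : b < a -> a != b.
Proof. by apply: contraTneq => ->; rewrite ltnn. Qed.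

Section LeAdd.

Variable n : nat.
Implicit Types m x y z w : 'X_{1..n}.

Local Ltac le_add := move=> /mnm_lepP le_xm; apply/mnm_lepP => i;
  have := le_xm i; rewrite !mnmDE; lia.

Lemma lem_add_l x m y z : (x <= m)%MM -> (x + z <= m + (y + z))%MM.
Proof. by le_add. Qed.

Lemma lem_add_r x m y z : (x <= m)%MM -> (y + x <= m + (y + z))%MM.
Proof. by le_add. Qed.

Lemma lem_add_r2 x m y z w : (x <= m)%MM -> (y + x <= m + (y + z + w))%MM.
Proof. by le_add. Qed.

Lemma lem_add_l3 x m y z w :
  (x <= m)%MM -> (x + z + w <= m + (y + z + w))%MM.
Proof. by le_add. Qed.

Lemma lem_add_r3 x m y z w :
  (x <= m)%MM -> (y + x + w <= m + (y + z + w))%MM.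
Proof. by le_add. Qed.

Lemma lem_add2l x y z w : (y + x + w <= y + z + w)%MM -> (x <= z)%MM.
Proof.
move=> /mnm_lepP le; apply/mnm_lepP => i; have := le i; rewrite !mnmDE; lia.
Qed.

End LeAdd.

Section PairOrder.

Variable h : nat.
Implicit Types (i j : 'I_h) (p q : 'I_h * 'I_h).

(** The order in which [Bpairs] lists the pairs. *)
Definition before p q := (q.1 < p.1) || (p.1 == q.1) && (q.2 < p.2).

Lemma pairwise_rev_enum : pairwise (fun i j => j < i) (rev (enum 'I_h)).
Proof.
rewrite -sorted_pairwise; last by move=> i j k ji kj; apply: ltn_trans kj ji.
rewrite rev_sorted.
by rewrite -(sorted_map (f := val) (e' := ltn)) val_enum_ord iota_ltn_sorted.
Qed.

Lemma pairwise_Bpairs : pairwise before (Bpairs h).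
Proof.
exact: pairwise_filter (pairwise_allpairs pairwise_rev_enum pairwise_rev_enum).
Qed.

Lemma before_asym p q : before p q -> ~~ before q p.
Proof.
case: p q => [a b] [c d]; rewrite /before /= -!(inj_eq val_inj) /=; lia.
Qed.

Lemma uniq_Bpairs : uniq (Bpairs h).
Proof.
by apply: pairwise_uniq pairwise_Bpairs => p; apply/negP => pp;
  have := before_asym pp; rewrite pp.
Qed.

Lemma mem_take_Bpairs p0 p k : k < size (Bpairs h) ->
  p \in take k (Bpairs h) <-> p.1 < p.2 /\ before p (nth p0 (Bpairs h) k).
Proof.
move=> ks; rewrite (mem_take_pairwise p0 _ before_asym pairwise_Bpairs) //.
by rewrite mem_Bpairs; split=> /andP.
Qed.

End PairOrder.

Section Colon.

Variables (K : fieldType) (l s t h : nat).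
Hypothesis l_gt0 : 0 < l.
Local Notation Y1 := (@Ymon1 l s t h).
Local Notation Y2 := (@Ymon2 l s t h).
Local Notation U := (@Umon l s t h).
Implicit Types (i j a b c : 'I_h) (p q : 'I_h * 'I_h).

Local Notation g1 p := (Y1 p.2 + Y2 p.1)%MM.
Local Notation g2 p := (Y1 p.2 + Y1 p.1 + U)%MM.
Local Notation g3 i := (Y1 i + Y1 i + U)%MM.

(** All colon ideals to be computed have this form. *)
Definition quotient_gens (P Q : pred 'I_h) : seq 'X_{1..#|{: Bedge l s t h}|} :=
  [seq Y1 b | b <- enum 'I_h & P b] ++ [seq Y2 a | a <- enum 'I_h & Q a].

Lemma quotient_gensP P Q m :
  (exists2 g, g \in quotient_gens P Q & (g <= m)%MM) <->
  (exists2 b, P b & (Y1 b <= m)%MM) \/ (exists2 a, Q a & (Y2 a <= m)%MM).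
Proof.
split=> [[g]|[[b Pb]|[a Qa]] le].
- rewrite mem_cat => /orP[] /mapP[b]; rewrite mem_filter => /andP[Pb _] -> le.
    by left; exists b.
  by right; exists b.
- exists (Y1 b) => //; rewrite mem_cat; apply/orP; left.
  by apply/map_f; rewrite mem_filter Pb mem_enum.
- exists (Y2 a) => //; rewrite mem_cat; apply/orP; right.
  by apply/map_f; rewrite mem_filter Qa mem_enum.
Qed.

Lemma Ymon_neq0 i : (Y1 i != 0%MM) * (Y2 i != 0%MM).
Proof. by rewrite -!mdeg_eq0 mdeg_Ymon1 mdeg_Ymon2 !gtn_eqF. Qed.

Lemma quotient_gens_deg P Q : all (fun m => mdeg m == l) (quotient_gens P Q).
Proof.
rewrite all_cat !all_map; apply/andP; split; apply/allP => i _ /=.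
  by rewrite mdeg_Ymon1.
by rewrite mdeg_Ymon2.
Qed.

Lemma quotient_gens_regular P Q :
  regular_sequence [seq 'X_[K, m] | m <- quotient_gens P Q].
Proof.
apply: coprime_regular; last first.
  apply/allP => g /(allP (quotient_gens_deg P Q)) /eqP deg.
  by rewrite -mdeg_eq0 deg gtn_eqF.
rewrite pairwise_cat; apply/and3P; split.
- by apply/allrelP => _ _ /mapP[b _ ->] /mapP[a _ ->]; rewrite coprimeE.
- apply: pairwise_map_uniq => [|a b _ _ ab]; last by rewrite coprimeE.
  by rewrite filter_uniq ?enum_uniq.
- apply: pairwise_map_uniq => [|a b _ _ ab]; last by rewrite coprimeE.
  by rewrite filter_uniq ?enum_uniq.
Qed.

Lemma colon_regular_quotient (P Q : pred nat) ms k :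
  (forall m, (exists2 g, g \in take k ms & (g <= m + nth 0%MM ms k)%MM) <->
     (exists2 b, P (b : 'I_h) & (Y1 b <= m)%MM) \/
     (exists2 a, Q (a : 'I_h) & (Y2 a <= m)%MM)) ->
  colon_regular K l ms k.+1 (count P (iota 0 h) + count Q (iota 0 h)).
Proof.
move=> kP; exists (quotient_gens P Q); split.
- by rewrite size_cat !size_map !size_filter !count_enum_ord.
- exact: quotient_gens_deg.
- exact: quotient_gens_regular.
- by apply: colon_mon_ideal => m; rewrite quotient_gensP; apply: kP.
Qed.

(** The pairs with the same first member give the [Y1 b] with [b] beyond [p.2],
    and those with the same second member give the [Y2 a] with [a] between
    [p.1] and [p.2].  Any other preceding generator [Y1 b Y2 a] has [a > p.1]:
    if [a < p.2] then [Y2 a] is one of these, and otherwise [b > a >= p.2], so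
    that [Y1 b] is. *)
Lemma colon_Y1Y2 p0 k : k < size (Bpairs h) ->
  let p := nth p0 (Bpairs h) k in
  colon_regular K l (Bgens l s t h) k.+1 (h - 2 - p.1).
Proof.
move=> ks p; have := mem_take_Bpairs p0 _ ks; rewrite -/p => takeP.
have ij : p.1 < p.2 by rewrite -mem_Bpairs mem_nth.
have -> : h - 2 - p.1 = count (fun b : nat => p.2.+1 <= b < h) (iota 0 h)
                      + count (fun a : nat => p.1.+1 <= a < p.2) (iota 0 h).
  by rewrite !count_iota_interval; have := ltn_ord p.2; lia.
apply: colon_regular_quotient => m.
rewrite take_cat nth_cat size_map ks (nth_map p0) // -map_take -/p.
split=> [[_ /mapP[q /takeP[lq bq] ->]]|].
- have [y1 y2] : (Y1 q.2 <= g1 q)%MM /\ (Y2 q.1 <= g1 q)%MM.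
    by rewrite lem_addr lem_addl.
  case/orP: bq => [pq|/andP[/eqP e1 e2]] le; last first.
    left; exists q.2; first by rewrite e2 ltn_ord.
    by apply: coprime_mnm_cancel y1 _ le; rewrite !coprimeE // gt_ord_neq.
  case: (ltnP q.1 p.2) => [q1p2|p2q1].
    right; exists q.1; first by rewrite pq.
    by apply: coprime_mnm_cancel y2 _ le; rewrite !coprimeE // gt_ord_neq.
  have p2q2 := leq_ltn_trans p2q1 lq.
  left; exists q.2; first by rewrite p2q2 ltn_ord.
  by apply: coprime_mnm_cancel y1 _ le; rewrite !coprimeE // gt_ord_neq.
- case=> [[b /andP[jb _] le]|[a /andP[ia aj] le]].
    exists (g1 (p.1, b)); last exact: lem_add_l.
    apply/map_f/takeP; split; first exact: ltn_trans jb.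
    by rewrite /before eqxx jb orbT.
  exists (g1 (a, p.2)); last exact: lem_add_r.
  by apply/map_f/takeP; rewrite /before /= ia.
Qed.

(** The [Y2 a] come from the generators [Y1 p.2 Y2 a], and the [Y1 b] from
    replacing one factor [Y1] of the given generator.  A generator [Y1 b Y2 a]
    with [a >= p.2] has [b > p.2]; a preceding [Y1 b Y1 a U] has a factor [Y1]
    with index above [p.1] and different from [p.2]. *)
Lemma colon_Y1Y1U p0 k : k < size (Bpairs h) ->
  let p := nth p0 (Bpairs h) k in
  colon_regular K l (Bgens l s t h) (size (Bpairs h) + k).+1
    (h - 2 - p.1 + p.2).
Proof.
move=> ks p; have := mem_take_Bpairs p0 _ ks; rewrite -/p => takeP.
have ij : p.1 < p.2 by rewrite -mem_Bpairs mem_nth.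
have -> : h - 2 - p.1 + p.2
    = count (fun b : nat => (p.1.+1 <= b) && (b != p.2)) (iota 0 h)
    + count (fun a : nat => 0 <= a < p.2) (iota 0 h).
  rewrite count_iota_interval count_iota_above.
  by have := ltn_ord p.2; lia.
apply: colon_regular_quotient => m.
rewrite take_cat nth_cat size_map ltnNge leq_addr /= addKn.
rewrite take_cat nth_cat size_map ks (nth_map p0) // -map_take -/p.
split=> [[g]|].
- rewrite mem_cat => /orP[] /mapP[q + ->].
    rewrite mem_Bpairs => lq le.
    case: (ltnP q.1 p.2) => [q1p2|p2q1].
      right; exists q.1 => //.
      apply: coprime_mnm_cancel (lem_addl _ _) _ le.
      by rewrite !coprimeE.
    have p2q2 := leq_ltn_trans p2q1 lq.
    left; exists q.2; first by rewrite (ltn_trans ij) // gtn_eqF.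
    apply: coprime_mnm_cancel (lem_addr _ _) _ le.
    by rewrite !coprimeE // gt_ord_neq // (ltn_trans ij).
  case/takeP => lq bq le.
  have [y1 y2] : (Y1 q.2 <= g2 q)%MM /\ (Y1 q.1 <= g2 q)%MM.
    by split; rewrite (lepm_trans _ (lem_addr _ _)) ?lem_addr ?lem_addl.
  have [b [yb ib bj]] : exists b,
      [/\ (Y1 b <= g2 q)%MM, p.1 < b & (b : nat) != p.2].
    case/orP: bq => [pq|/andP[/eqP e1 e2]]; last first.
      by exists q.2; rewrite (ltn_trans ij) // gtn_eqF.
    have [e|ne] := eqVneq (q.1 : nat) p.2; last by exists q.1.
    by exists q.2; rewrite (ltn_trans pq) // gtn_eqF // -e.
  left; exists b; first by rewrite ib.
  apply: coprime_mnm_cancel yb _ le.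
  by rewrite !coprimeE // gt_ord_neq.
- case=> [[b /andP[ib bj] le]|[a aj le]]; last first.
    exists (g1 (a, p.2)); last exact: lem_add_r2.
    rewrite mem_cat; apply/orP; left; apply/mapP.
    by exists (a, p.2); rewrite ?mem_Bpairs.
  case: (ltngtP b p.2) bj => // [bj|jb] _.
    exists (g2 (b, p.2)); last exact: lem_add_r3.
    rewrite mem_cat orbC; apply/orP; left; apply/map_f/takeP.
    by rewrite /before ib.
  exists (g2 (p.1, b)); last exact: lem_add_l3.
  rewrite mem_cat orbC; apply/orP; left; apply/map_f/takeP.
  by rewrite /before eqxx jb orbT.
Qed.

(** Here the whole block of the generators [Y1 j Y1 i U] precedes, so every [Y1 b]
    with [b != i] is a quotient; only [Y1 i Y2 a] gives something else. *)
Lemma colon_Y1sqU i0 k : k < h ->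
  let i := nth i0 (rev (enum 'I_h)) k in
  colon_regular K l (Bgens l s t h)
    (size (Bpairs h) + (size (Bpairs h) + k)).+1 (h - 1 + i).
Proof.
move=> kh i.
have -> : h - 1 + i = count (fun b : nat => (0 <= b) && (b != i)) (iota 0 h)
                    + count (fun a : nat => 0 <= a < i) (iota 0 h).
  rewrite count_iota_interval count_iota_above.
  by have := ltn_ord i; lia.
have ks : k < size (rev (enum 'I_h)) by rewrite size_rev size_enum_ord.
apply: colon_regular_quotient => m.
rewrite take_cat nth_cat size_map ltnNge leq_addr /= addKn.
rewrite take_cat nth_cat size_map ltnNge leq_addr /= addKn.
rewrite (nth_map i0) // -map_take -/i.
split=> [[g]|].
- rewrite !mem_cat => /or3P[] /mapP[q + ->].
  + rewrite mem_Bpairs => lq le; case: (eqVneq q.2 i) => [qi|ni].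
      right; exists q.1; first by rewrite -qi.
      by apply: coprime_mnm_cancel (lem_addl _ _) _ le; rewrite !coprimeE.
    left; exists q.2 => //.
    by apply: coprime_mnm_cancel (lem_addr _ _) _ le; rewrite !coprimeE.
  + rewrite mem_Bpairs => lq le.
    have [b [yb bi]] : exists b, (Y1 b <= g2 q)%MM /\ b != i.
      have [e|ne] := eqVneq q.1 i.
        exists q.2; split; last by rewrite -e gt_ord_neq.
        by rewrite (lepm_trans _ (lem_addr _ _)) ?lem_addr.
      exists q.1; split=> //.
      by rewrite (lepm_trans _ (lem_addr _ _)) ?lem_addl.
    left; exists b => //.
    by apply: coprime_mnm_cancel yb _ le; rewrite !coprimeE.
  + have asym (a b : 'I_h) : b < a -> ~~ (a < b) by lia.
    rewrite (mem_take_pairwise i0 _ asym (pairwise_rev_enum h)) // -/i.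
    move=> /andP[_ iq] le; left; exists q; first by rewrite gt_ord_neq.
    have yq : (Y1 q <= g3 q)%MM.
      by rewrite (lepm_trans _ (lem_addr _ _)) ?lem_addl.
    by apply: coprime_mnm_cancel yq _ le; rewrite !coprimeE // gt_ord_neq.
- case=> [[b /= bi le]|[a ai le]]; last first.
    exists (g1 (a, i)); last exact: lem_add_r2.
    rewrite mem_cat; apply/orP; left; apply/mapP.
    by exists (a, i); rewrite ?mem_Bpairs.
  case: (ltngtP b i) bi => // [bi|ib] _.
    exists (g2 (b, i)); last exact: lem_add_r3.
    rewrite !mem_cat; apply/or3P/Or32/mapP.
    by exists (b, i); rewrite ?mem_Bpairs.
  exists (g2 (i, b)); last exact: lem_add_l3.
  rewrite !mem_cat; apply/or3P/Or32/mapP.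
  by exists (i, b); rewrite ?mem_Bpairs.
Qed.

End Colon.

(** * Minimality of the generators *)

Section Antichain.

Variables (l s t h : nat).
Hypothesis l_gt0 : 0 < l.
Local Notation Y1 := (@Ymon1 l s t h).
Local Notation Y2 := (@Ymon2 l s t h).
Local Notation U := (@Umon l s t h).
Implicit Types (i j a b : 'I_h) (p q : 'I_h * 'I_h).

Local Notation g1 p := (Y1 p.2 + Y2 p.1)%MM.
Local Notation g2 p := (Y1 p.2 + Y1 p.1 + U)%MM.

Lemma Ymon1_le_coprime i f : (Y1 i <= f)%MM -> ~~ coprime_mnm (Y1 i) f.
Proof.
move=> le; apply/negP => cop; have := coprime_mnm_0 (lepm_refl _) cop le.
by apply/eqP; rewrite Ymon_neq0.
Qed.

Lemma Ymon2_le_coprime i f : (Y2 i <= f)%MM -> ~~ coprime_mnm (Y2 i) f.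
Proof.
move=> le; apply/negP => cop; have := coprime_mnm_0 (lepm_refl _) cop le.
by apply/eqP; rewrite Ymon_neq0.
Qed.

Lemma Ymon1_le i j : (Y1 i <= Y1 j)%MM -> i = j.
Proof.
by move/Ymon1_le_coprime; apply: contraNeq => ij; rewrite coprime_Ymon1.
Qed.

Lemma Y1Y2_le p q : (g1 p <= g1 q)%MM -> p = q.
Proof.
case: p q => [a b] [i j] /= le.
have : (Y1 b <= Y1 j + Y2 i)%MM by apply: lepm_trans le; apply: lem_addr.
have : (Y2 a <= Y1 j + Y2 i)%MM by apply: lepm_trans le; apply: lem_addl.
move=> /Ymon2_le_coprime na /Ymon1_le_coprime nb; congr (_, _).
  apply: contraNeq na => ai.
  by rewrite !coprimeE.
apply: contraNeq nb => bj.
by rewrite !coprimeE.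
Qed.

Lemma Y1Y1U_mem c p : (Y1 c <= g2 p)%MM -> c = p.2 \/ c = p.1.
Proof.
move/Ymon1_le_coprime => nc; case: (eqVneq c p.2) => [|c2]; first by left.
right; apply: contraNeq nc => c1.
by rewrite !coprimeE.
Qed.

Lemma Y1Y1U_le p q : p.1 <= p.2 -> q.1 <= q.2 -> (g2 p <= g2 q)%MM -> p = q.
Proof.
case: p q => [a b] [i j] /= ab ij le.
have [] : b = j \/ b = i.
- apply: (@Y1Y1U_mem b (i, j)) => /=; apply: lepm_trans le.
  exact: lepm_trans (lem_addr _ _) (lem_addr _ _).
- by move=> bj; move: le; rewrite bj => /lem_add2l /Ymon1_le ->.
- move=> bi; move: le; rewrite bi (addmC (Y1 j)) => /lem_add2l /Ymon1_le aj.
  have ji : i = j by apply: val_inj; apply/eqP; rewrite eqn_leq ij -bi -aj ab.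
  by rewrite aj -ji.
Qed.

(** Only the generators [Y1 j Y2 i] have a factor [Y2] and only the others have
    the factor [U]; within each kind the other factors determine the indices. *)
Lemma Bgens_antichain :
  pairwise (fun u v => ~~ (u <= v)%MM && ~~ (v <= u)%MM) (Bgens l s t h).
Proof.
have no21 p q : ~~ (g2 q <= g1 p)%MM.
  apply/negP => le; have U_le : (U <= g1 p)%MM := lepm_trans (lem_addl _ _) le.
  have copU : coprime_mnm U (g1 p).
    apply: coprime_mnmD; apply: coprime_mnm_sym; first exact: coprime_Ymon1U.
    exact: coprime_Ymon2U.
  have := coprime_mnm_0 (lepm_refl U) copU U_le.
  by move/(congr1 (@mdeg _)); rewrite mdeg_Umon mdeg0 addn1.
have no12 p q : ~~ (g1 p <= g2 q)%MM.
  apply/negP => le; have := lepm_trans (lem_addl _ _) le.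
  move/Ymon2_le_coprime/negP; apply.
  by rewrite !coprimeE.
rewrite /Bgens !pairwise_cat allrel_catr; apply/and5P; split.
- apply/andP; split; apply/allrelP => _ _ /mapP[p _ ->] /mapP[q _ ->].
    by rewrite no12 no21.
  by rewrite (no12 p (q, q)) (no21 p (q, q)).
- apply: pairwise_map_uniq => [|p q _ _ pq]; first exact: uniq_Bpairs.
  by apply/andP; split; apply: contra_neqN pq => /Y1Y2_le ->.
- apply/allrelP => _ _ /mapP[p + ->] /mapP[q _ ->]; rewrite mem_Bpairs => lp.
  apply/andP; split; apply/negP.
    move/(@Y1Y1U_le p (q, q) (ltnW lp) (leqnn _)) => pq.
    by move: lp; rewrite pq ltnn.
  move/(@Y1Y1U_le (q, q) p (leqnn _) (ltnW lp)) => pq.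
  by move: lp; rewrite -pq ltnn.
- apply: pairwise_map_uniq => [|p q + + pq]; first exact: uniq_Bpairs.
  rewrite !mem_Bpairs => /ltnW lp /ltnW lq.
  apply/andP; split; apply: contra_neqN pq; first by move/(Y1Y1U_le lp lq).
  by move/(Y1Y1U_le lq lp).
- apply: pairwise_map_uniq => [|p q _ _ pq]; first by rewrite rev_uniq enum_uniq.
  apply/andP; split; apply: contra_neqN pq.
    by move/(@Y1Y1U_le (p, p) (q, q) (leqnn _) (leqnn _)) => -[].
  by move/(@Y1Y1U_le (q, q) (p, p) (leqnn _) (leqnn _)) => -[].
Qed.

End Antichain.

(** * Lengths of the regular sequences *)

Section Lengths.

Variable h : nat.

(** The block of the generators [Y1 j Y2 i]; its first entry, [0], stands for
    the generator that has no predecessor. *)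
Definition path_lengths : seq nat :=
  [seq h - 2 - p.1 | p : 'I_h * 'I_h <- Bpairs h].

(** The two blocks of generators that contain [U]. *)
Definition cycle_lengths : seq nat :=
  [seq h - 2 - p.1 + p.2 | p : 'I_h * 'I_h <- Bpairs h]
  ++ [seq h - 1 + i | i : 'I_h <- rev (enum 'I_h)].

Lemma map_Bpairs (T : Type) (F : nat -> nat -> T) :
  [seq F p.1 p.2 | p : 'I_h * 'I_h <- Bpairs h]
  = flatten [seq [seq F i j | j <- rev (iota 0 h) & i < j]
             | i <- rev (iota 0 h)].
Proof.
rewrite /Bpairs filter_flatten map_flatten -!map_comp.
rewrite -val_enum_ord -(map_rev val) -[in RHS]map_comp; congr flatten.
apply: eq_map => i /=; by rewrite !filter_map -!map_comp.
Qed.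

Lemma rev_iota_sub : [seq h.-1 - i | i <- rev (iota 0 h)] = iota 0 h.
Proof.
apply: (@eq_from_nth _ 0) => [|i]; rewrite size_map size_rev size_iota // => ih.
rewrite (nth_map 0) ?size_rev ?size_iota // nth_rev ?size_iota //.
by rewrite !nth_iota //; lia.
Qed.

(** Pairs with the same first member [i] share one length, and there are
    [h - 1 - i] of them. *)
Lemma path_lengthsE :
  path_lengths = flatten [seq nseq c c.-1 | c <- iota 0 h].
Proof.
rewrite /path_lengths (map_Bpairs (fun i _ => h - 2 - i)).
rewrite -[in RHS]rev_iota_sub -map_comp; congr flatten.
apply/eq_in_map => i; rewrite mem_rev mem_iota /= => ih.
have E c n (u : seq nat) : size u = n -> [seq c | _ <- u] = nseq n c.
  by move=> <-; elim: u => //= _ u ->.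
have -> : h - 2 - i = (h.-1 - i).-1 by lia.
apply: E; rewrite size_filter count_rev.
rewrite (@eq_in_count _ _ (fun j => i.+1 <= j < h)).
  by rewrite count_iota_interval; lia.
by move=> j; rewrite mem_iota => /= jh; rewrite jh andbT.
Qed.

Lemma size_Bpairs : size (Bpairs h) = (h * (h - 1)) %/ 2.
Proof.
rewrite -(size_map (fun p : 'I_h * 'I_h => h - 2 - p.1)) -/path_lengths.
rewrite path_lengthsE size_flatten /shape -map_comp.
rewrite (eq_map (g := id)) => [|c]; last by rewrite /= size_nseq.
have := bin2_sum h; rewrite /index_iota subn0 => binE.
by rewrite map_id sumnE binE bin2 divn2 subn1.
Qed.

Lemma head_path_lengths : 2 <= h ->
  path_lengths = 0 :: flatten [seq nseq c.+1 c | c <- iota 1 (h - 2)].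
Proof.
move=> h2; have hE : h = 2 + (h - 2) by lia.
rewrite path_lengthsE [in LHS]hE iotaD /= (iotaDl 1 1) -map_comp.
by congr (_ :: flatten _); apply: eq_map.
Qed.

Lemma cycle_lengths_range k : k \in cycle_lengths -> h - 1 <= k <= 2 * h - 2.
Proof.
rewrite mem_cat => /orP[] /mapP[p +] ->.
  case: p => i j; rewrite mem_Bpairs /=; have := ltn_ord j; lia.
by have := ltn_ord p; lia.
Qed.

Lemma count_pairs d : 0 < d ->
  count (fun p : 'I_h * 'I_h => p.2 == p.1 + d :> nat) (Bpairs h) = h - d.
Proof.
move=> d0; have -> (s : seq ('I_h * 'I_h)) :
    count (fun p : 'I_h * 'I_h => p.2 == p.1 + d :> nat) s
    = count id [seq p.1 + d == p.2 | p : 'I_h * 'I_h <- s].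
  by rewrite count_map; apply: eq_count => p; rewrite /= eq_sym.
rewrite (map_Bpairs (fun i j => i + d == j)) count_flatten -map_comp.
rewrite (iffLR (eq_in_map _ (fun i => (0 <= i < h - d) : nat) _)); last first.
  move=> i; rewrite mem_rev mem_iota /= => ih.
  rewrite count_map count_filter count_rev.
  rewrite (eq_count (a2 := fun j => i + d <= j < (i + d).+1)) => [|j].
    by rewrite count_iota_interval; lia.
  by rewrite /=; lia.
have -> (u : seq nat) (P : pred nat) :
    sumn [seq P i : nat | i <- u] = count P u.
  by elim: u => //= i u ->.
by rewrite count_rev count_iota_interval; lia.
Qed.

(** The length of a pair in the second block depends on the difference of its
    members only, and the squares contribute each length exactly once. *)
Lemma count_cycle_lengths p : 0 < h -> h - 1 <= p <= 2 * h - 2 ->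
  count (pred1 p) cycle_lengths = 2 * h - p - 1.
Proof.
move=> h_gt0 hp; rewrite count_cat !count_map count_rev.
have -> : count (preim (fun i : 'I_h => h - 1 + i) (pred1 p)) (enum 'I_h) = 1.
  rewrite [LHS](count_enum_ord h (fun i => h - 1 + i == p)).
  rewrite (eq_count (a2 := fun i => p - (h - 1) <= i < (p - (h - 1)).+1)).
    by rewrite count_iota_interval; lia.
  by move=> i /=; lia.
rewrite (eq_in_count
  (a2 := fun q : 'I_h * 'I_h => q.2 == q.1 + (p + 2 - h) :> nat)).
  by rewrite count_pairs; lia.
move=> [i j]; rewrite mem_Bpairs /= => ij.
by have := ltn_ord j; lia.
Qed.

End Lengths.

Lemma card_set_count n (P : pred nat) :
  #|[set k : 'I_n | P k]| = count P (iota 0 n).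
Proof.
rewrite -count_enum_ord cardsE cardE -size_filter; congr size.
by rewrite enumT.
Qed.

Lemma count_nth_shift (u v : seq nat) p :
  count (fun k => (size u + 1 <= k) && (nth 0 (u ++ v) k.-1 == p))
    (iota 0 (size u + size v).+1) = count (pred1 p) v.
Proof.
have -> : (size u + size v).+1 = size u + 1 + size v by lia.
rewrite iotaD count_cat [X in X + _](_ : _ = 0); last first.
  rewrite -[RHS](count_pred0 (iota 0 (size u + 1))); apply: eq_in_count => k.
  by rewrite mem_iota add0n => /andP[_]; rewrite ltnNge => /negPf->.
rewrite !add0n -[X in _ = count _ X](mkseq_nth 0) /mkseq count_map.
rewrite -[X in iota X _]addn0 iotaDl count_map; apply: eq_count => k /=.
by rewrite leq_addr addn1 addSn /= nth_cat ltnNge leq_addr addKn.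
Qed.

Lemma colon_regular_Bgens (K : fieldType) l s t h k : 0 < l -> 0 < h ->
  k < size (Bgens l s t h) ->
  colon_regular K l (Bgens l s t h) k.+1
    (nth 0 (path_lengths h ++ cycle_lengths h) k).
Proof.
move=> l_gt0 h_gt0; pose i0 := Ordinal h_gt0.
rewrite !size_cat !size_map size_rev size_enum_ord => kn.
rewrite nth_cat size_map; case: ltnP => [k1|k1].
  by rewrite (nth_map (i0, i0)) //; apply: colon_Y1Y2.
rewrite nth_cat size_map -{1}(subnKC k1); case: ltnP => [k2|k2].
  by rewrite (nth_map (i0, i0)) //; apply: colon_Y1Y1U.
rewrite (nth_map i0) -1?{1}(subnKC k2); last first.
  by rewrite size_rev size_enum_ord; lia.
by apply: colon_Y1sqU => //; lia.
Qed.

Theorem proposition5p3 (K : fieldType) (l s t h : nat)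
    (hl : 1 <= l) (hs : 1 <= s) (ht : 1 <= t) (hh : 2 <= h) :
  size (Bgens l s t h) = h ^ 2 /\
  has_regular_quotients l
    (initial_ideal (grevlex (Bvars l s t h))
       (toric_ideal K (@Bends l s t h)))
    (Bgens l s t h) /\
  exists r : nat -> nat,
    [/\ forall k, 2 <= k <= h ^ 2 -> colon_regular K l (Bgens l s t h) k (r k),
        [seq r k | k <- iota 2 ((h * (h - 1)) %/ 2 - 1)]
          = flatten [seq nseq c.+1 c | c <- iota 1 (h - 2)],
        forall k, (h * (h - 1)) %/ 2 + 1 <= k <= h ^ 2 ->
          h - 1 <= r k <= 2 * h - 2
      & forall p, h - 1 <= p <= 2 * h - 2 ->
          #|[set k : 'I_(h ^ 2).+1 |
               ((h * (h - 1)) %/ 2 + 1 <= k) && (r k == p)]|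
          = 2 * h - p - 1].
Proof.
have h_gt0 : 0 < h by apply: ltnW.
have sq : h ^ 2 = (h * (h - 1)) %/ 2 + ((h * (h - 1)) %/ 2 + h).
  have ev : ~~ odd (h * (h - 1)) by rewrite oddM oddB // andbC; case: odd.
  by rewrite addnA addnn divn2 even_halfK //; nia.
have sizeE : size (Bgens l s t h) = h ^ 2.
  by rewrite !size_cat !size_map size_rev size_enum_ord size_Bpairs sq.
have size_path : size (path_lengths h) = (h * (h - 1)) %/ 2.
  by rewrite size_map size_Bpairs.
have size_cycle : size (cycle_lengths h) = (h * (h - 1)) %/ 2 + h.
  by rewrite size_cat !size_map size_rev size_enum_ord size_Bpairs.
pose r k := nth 0 (path_lengths h ++ cycle_lengths h) k.-1.
have colonP k : 2 <= k <= h ^ 2 -> colon_regular K l (Bgens l s t h) k (r k).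
  by case: k => // k /andP[_ kh]; apply: colon_regular_Bgens; rewrite ?sizeE.
split=> //; split.
  split=> [|k]; last by rewrite sizeE => /colonP; exists (r k).
  apply: antichain_minimal (Bgens_antichain s t h hl).
  exact: initial_ideal_Bgens.
exists r; split=> // [|k /andP[k1 k2]|p hp].
- have E := head_path_lengths hh.
  set F := flatten _ in E *.
  have nF : (h * (h - 1)) %/ 2 - 1 = size F by rewrite -size_path E /= subn1.
  rewrite nF (iotaDl 1 1) -map_comp (map_nth_iota 0); last first.
    by rewrite size_cat E /= subn1 leq_addr.
  by rewrite E /= drop0 take_size_cat.
- apply: cycle_lengths_range; rewrite /r nth_cat size_path.
  have -> : (k.-1 < (h * (h - 1)) %/ 2) = false by lia.
  by apply: mem_nth; rewrite size_cycle; lia.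
- rewrite -(count_cycle_lengths h_gt0 hp) -(count_nth_shift (path_lengths h)).
  rewrite size_path size_cycle -sq.
  exact: (card_set_count _ (fun k => (_ <= k) && (r k == p))).
Qed.
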